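(* Let $\mathcal{S}$ be one of the following 19 step sets (with $N=(0,1)$, $S=(0,-1)$, $E=(1,0)$, $W=(-1,0)$, $NE=(1,1)$, $NW=(-1,1)$, $SE=(1,-1)$, $SW=(-1,-1)$): $\{N,S,E,W\}$; $\{NE,SE,NW,SW\}$; $\{N,S,NE,SE,NW,SW\}$; $\{N,S,E,W,NE,NW,SE,SW\}$; $\{NE,NW,S\}$; $\{N,NW,NE,S\}$; $\{NE,NW,E,W,S\}$; $\{N,NE,NW,SE,SW\}$; $\{N,NW,NE,E,W,S\}$; $\{N,E,W,NE,NW,SE,SW\}$; $\{N,W,SE\}$; $\{NW,SE,N,S,E,W\}$; $\{N,SE,SW\}$; $\{N,S,SE,SW\}$; $\{N,E,W,SE,SW\}$; $\{NE,NW,SE,SW,S\}$; $\{N,E,W,S,SW,SE\}$; $\{NE,NW,E,W,SE,SW,S\}$; $\{E,SE,W,NW\}$. Then for $a,b\in\{0,1\}$, \[ C(a,b,t)=\Delta\left(\frac{xy\,O(1/x,1/y)}{1-txy\,S(1/x,1/y)}\cdot(1-x)^{-a}(1-y)^{-b}\right), \] where $O(x,y)=\sum_{g\in\mathcal{G}}\operatorname{sgn}(g)\,g(xy)$.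
   Context: A walk of length $n$ with steps in $\mathcal{S}\subseteq\{-1,0,1\}^2\setminus\{(0,0)\}$ is a sequence of lattice points $p_0=(0,0),p_1,\dots,p_n$ with $p_k-p_{k-1}\in\mathcal{S}$; it is a quadrant walk if all $p_k\in\mathbb{Z}_{\ge0}^2$. Let $c_{i,j,n}$ be the number of quadrant walks of length $n$ ending at $(i,j)$ and $C(x,y,t)=\sum_{i,j,n\ge0}c_{i,j,n}x^iy^jt^n$. The characteristic polynomial is $S(x,y)=\sum_{(i,j)\in\mathcal{S}}x^iy^j$, written $S(x,y)=y^{-1}A_{-1}(x)+A_0(x)+yA_1(x)=x^{-1}B_{-1}(y)+B_0(y)+xB_1(y)$ with Laurent polynomials $A_k,B_k$. $\mathcal{G}$ is the group of birational maps of the plane generated by the involutions $\Phi(x,y)=\big(x,\,y^{-1}A_{-1}(x)/A_1(x)\big)$ and $\Psi(x,y)=\big(x^{-1}B_{-1}(y)/B_1(y),\,y\big)$ (finite for these step sets); for $g\in\mathcal{G}$, $g(xy)$ denotes the product of the two coordinates of $g(x,y)$, and $\operatorname{sgn}(g)=(-1)^{\ell(g)}$ where $\ell(g)$ is the minimal length of a word in $\Phi,\Psi$ representing $g$. For a rational function $F(x,y,t)$, $\Delta F=\sum_n f_{n,n,n}t^n$ where $f_{i,j,n}$ are the coefficients of the Laurent series expansion of $F$ at the origin. *)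

(* Defs.v *)
(* MathComp, with multinomials for polynomials and mathcomp-classical for sums
   over finite sets of an arbitrary choiceType. *)
From HB Require Import structures.
From mathcomp Require Import all_boot all_order all_algebra.
From mathcomp Require Import finmap.
From mathcomp Require Import boolp classical_sets fsbigop.
From mathcomp Require Import mpoly.

Set Implicit Arguments.
Unset Strict Implicit.
Unset Printing Implicit Defensive.

Import Order.TTheory GRing.Theory Num.Theory.
Local Open Scope ring_scope.
Local Open Scope fset_scope.

Definition stepset := {fset int * int}.

Definition dN  : int * int := (0, 1).
Definition dS  : int * int := (0, -1).
Definition dE  : int * int := (1, 0).
Definition dW  : int * int := (-1, 0).
Definition dNE : int * int := (1, 1).
Definition dNW : int * int := (-1, 1).
Definition dSE : int * int := (1, -1).
Definition dSW : int * int := (-1, -1).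

Definition step_sets : seq stepset :=
  [:: [fset dN; dS; dE; dW];
      [fset dNE; dSE; dNW; dSW];
      [fset dN; dS; dNE; dSE; dNW; dSW];
      [fset dN; dS; dE; dW; dNE; dNW; dSE; dSW];
      [fset dNE; dNW; dS];
      [fset dN; dNW; dNE; dS];
      [fset dNE; dNW; dE; dW; dS];
      [fset dN; dNE; dNW; dSE; dSW];
      [fset dN; dNW; dNE; dE; dW; dS];
      [fset dN; dE; dW; dNE; dNW; dSE; dSW];
      [fset dN; dW; dSE];
      [fset dNW; dSE; dN; dS; dE; dW];
      [fset dN; dSE; dSW];
      [fset dN; dS; dSE; dSW];
      [fset dN; dE; dW; dSE; dSW];
      [fset dNE; dNW; dSE; dSW; dS];
      [fset dN; dE; dW; dS; dSW; dSE];
      [fset dNE; dNW; dE; dW; dSE; dSW; dS];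
      [fset dE; dSE; dW; dNW]].

(* A walk of length n is given by its n steps; [walk_point w k] is p_k. *)
Definition walk_point (St : stepset) (n : nat) (w : n.-tuple St) (k : nat) :
    int * int :=
  \sum_(s <- take k w) val s.

Definition quadrant_walk (St : stepset) (n : nat) (w : n.-tuple St) : bool :=
  [forall k : 'I_n.+1,
    (0 <= (walk_point w k).1) && (0 <= (walk_point w k).2)].

Definition nb_walks (St : stepset) (i j n : nat) : nat :=
  #|[pred w : n.-tuple St |
      quadrant_walk w && (walk_point w n == (i%:Z, j%:Z))]|.

(* The coefficient of t^n in C(x,y,t).  For steps in {-1,0,1}^2 a walk of
   length n cannot end outside [0,n]^2, so the sum over i and j is complete. *)
Definition walk_gf (St : stepset) (x y : rat) (n : nat) : rat :=
  \sum_(i < n.+1) \sum_(j < n.+1) (nb_walks St i j n)%:R * x ^+ i * y ^+ j.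

(* The Laurent polynomials S, A_k and B_k, as functions on a field. *)
Definition charS (L : fieldType) (St : stepset) (x y : L) : L :=
  \sum_(s <- St) x ^ s.1 * y ^ s.2.
Definition charA (L : fieldType) (St : stepset) (k : int) (x : L) : L :=
  \sum_(s <- St | s.2 == k) x ^ s.1.
Definition charB (L : fieldType) (St : stepset) (k : int) (y : L) : L :=
  \sum_(s <- St | s.1 == k) y ^ s.2.

Definition Phi (L : fieldType) (St : stepset) (p : L * L) : L * L :=
  (p.1, p.2^-1 * charA St (-1) p.1 / charA St 1 p.1).
Definition Psi (L : fieldType) (St : stepset) (p : L * L) : L * L :=
  (p.1^-1 * charB St (-1) p.2 / charB St 1 p.2, p.2).

Definition ratfun2 := {fraction {mpoly rat[2]}}.
Definition ratfun3 := {fraction {mpoly rat[3]}}.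

Definition x2 : ratfun2 := FracField.tofrac 'X_(@Ordinal 2 0 isT).
Definition y2 : ratfun2 := FracField.tofrac 'X_(@Ordinal 2 1 isT).
Definition x3 : ratfun3 := FracField.tofrac 'X_(@Ordinal 3 0 isT).
Definition y3 : ratfun3 := FracField.tofrac 'X_(@Ordinal 3 1 isT).
Definition t3 : ratfun3 := FracField.tofrac 'X_(@Ordinal 3 2 isT).

(* A birational map of the plane is represented by its pair of coordinate
   functions, i.e. by its value at the generic point (x, y) over Q(x,y).
   Composing g on the left with Phi amounts to applying Phi to that pair. *)
Definition birat := (ratfun2 * ratfun2)%type.

(* The product of generators spelled by w, with true for Phi, false for Psi. *)
Definition word_map (St : stepset) (w : seq bool) : birat :=
  foldr (fun b g => if b then Phi St g else Psi St g) (x2, y2) w.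

(* As Phi and Psi are involutions, the words give the whole group. *)
Definition walk_group (St : stepset) : set birat :=
  [set g | exists w : seq bool, word_map St w = g]%classic.

Definition word_length (St : stepset) (g : birat) (n : nat) : bool :=
  [exists w : n.-tuple bool, word_map St w == g].

(* l(g); the value 0 off the group is never used. *)
Definition group_length (St : stepset) (g : birat) : nat :=
  if pselect (exists n, word_length St g n) is left h then ex_minn h else 0.

(* The finitely supported sum over the group; it would be 0 by convention if
   the group were infinite. *)
Definition orbit_sum (St : stepset) : ratfun2 :=
  (\sum_(g \in walk_group St) (-1) ^+ group_length St g * (g.1 * g.2))%R.

(* F(u,v).  The value does not depend on the chosen representative of F when
   u and v are algebraically independent over Q, e.g. for (1/x, 1/y). *)
Definition ratfun_eval (F : ratfun2) (u v : ratfun3) : ratfun3 :=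
  let ev := mmap (@FracField.tofrac _ \o @mpolyC 3 rat)
                 (fun i : 'I_2 => if val i == 0%N then u else v) in
  ev (\n_(repr F)) / ev (\d_(repr F)).

(* Coefficients f i j k of x^i y^j t^k. *)
Definition laurent := int -> int -> int -> rat.

Definition laurent1 : laurent :=
  fun i j k => ((i == 0) && (j == 0) && (k == 0))%:R.

Definition poly_mul (P : {mpoly rat[3]}) (f : laurent) : laurent :=
  fun i j k => \sum_(m <- msupp P)
    P@_m * f (i - (m (@Ordinal 3 0 isT))%:Z)
             (j - (m (@Ordinal 3 1 isT))%:Z)
             (k - (m (@Ordinal 3 2 isT))%:Z).

(* f is the expansion of F in Q[[x,y,t]][1/(xyt)], the formal Laurent series
   with exponents bounded below: with F = P / Q, it satisfies Q f = P.  That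
   ring is an integral domain, so f is unique and independent of P and Q. *)
Definition laurent_expansion (F : ratfun3) (f : laurent) : Prop :=
  (exists N : int, forall i j k,
      f i j k != 0 -> [&& N <= i, N <= j & N <= k]) /\
  (exists P Q : {mpoly rat[3]},
      [/\ Q != 0, F = FracField.tofrac P / FracField.tofrac Q
        & forall i j k, poly_mul Q f i j k = poly_mul P laurent1 i j k]).

(* u is the coefficient sequence of the diagonal of F; this includes the
   existence of the expansion of F. *)
Definition is_diagonal (F : ratfun3) (u : nat -> rat) : Prop :=
  exists2 f, laurent_expansion F f & forall n : nat, u n = f n%:Z n%:Z n%:Z.

(* Main.v *)
(* The coefficients of O(x,y) S(x,y)^n, with O expanded at infinity, obey the
   same recurrence in n as the numbers of walks.  They vanish on both axes,
   because O S^n changes sign under the reflections Phi and Psi, so in the open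
   quadrant they satisfy the initial and boundary conditions of
   xy C(x,y,t) and agree with it.  The diagonal of the theorem extracts these
   coefficients: the substitution x, y -> 1/x, 1/y turns the expansion at
   infinity into one at the origin, and the factors 1/(1-x), 1/(1-y) sum over
   the end point.  Three step sets have monomial Phi and Psi; for the sixteen
   others, which are symmetric in a vertical axis,
   O = (x - 1/x)(y - A_{-1}(x) / (A_1(x) y)). *)
Require Import Defs.
From HB Require Import structures.
From mathcomp Require Import all_boot all_order all_algebra.
From mathcomp Require Import finmap mpoly.
From mathcomp Require Import boolp classical_sets fsbigop.
From mathcomp Require Import ring lra zify.

Import Order.TTheory GRing.Theory Num.Theory.
Local Open Scope ring_scope.

(** For the sixteen symmetric sets the antisymmetry of O S^n is not a symmetry of its coefficient
    array: y -> A_{-1}/(A_1 y) does not act on exponents, and x -> 1/x turns the expansion of 1/A_1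
    at infinity into the one at zero. The first reflection is therefore stated row by row with
    denominators cleared, which kills the row q = 0. That zero row separates the half-plane q >= 0
    from the lower rows, where the series 1/A_1 enters. Above it the initial value is (x - 1/x) y,
    negated term by term by x -> 1/x, so the column p = 0 vanishes for q >= 0; the recurrence in the
    quadrant needs no more. For the three monomial sets both reflections are linear on exponents and
    the whole array is antisymmetric. Expansions are certified by multiplying out: an explicit array
    is exhibited and checked against one denominator at a time. Denominators met along the orbits
    are nonzero because they are free of subtraction, hence positive at positive points. *)

(** * Polynomials acting on coefficient arrays *)

Lemma poly_mul_widen (P : {mpoly rat[3]}) (s : seq 'X_{1..3}) (f : laurent)
    (i j k : int) :
  uniq s -> {subset msupp P <= s} ->
  poly_mul P f i j k = \sum_(m <- s) P@_m *
    f (i - (m (@Ordinal 3 0 isT))%:Z) (j - (m (@Ordinal 3 1 isT))%:Z)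
      (k - (m (@Ordinal 3 2 isT))%:Z).
Proof.
move=> us sub; rewrite [RHS](bigID (mem (msupp P))) /= addrC big1 ?add0r; last first.
  by move=> m /memN_msupp_eq0 ->; rewrite mul0r.
rewrite -big_filter; apply: perm_big; apply: uniq_perm.
- exact: msupp_uniq.
- exact: filter_uniq.
by move=> m; rewrite mem_filter; case: (boolP (m \in _)) => // /sub.
Qed.

Lemma poly_mulD (P Q : {mpoly rat[3]}) (f : laurent) (i j k : int) :
  poly_mul (P + Q) f i j k = poly_mul P f i j k + poly_mul Q f i j k.
Proof.
pose s := undup (msupp P ++ msupp Q).
have us : uniq s by rewrite undup_uniq.
rewrite !(@poly_mul_widen _ s) // -?big_split /=.
- by apply: eq_bigr => m _; rewrite mcoeffD mulrDl.
- by move=> m mP; rewrite mem_undup mem_cat mP orbT.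
- by move=> m mP; rewrite mem_undup mem_cat mP.
- by move=> m mP; rewrite mem_undup msuppD_le.
Qed.

Lemma poly_mulZX (c : rat) (m : 'X_{1..3}) (f : laurent) (i j k : int) :
  poly_mul (c *: 'X_[m]) f i j k =
  c * f (i - (m (@Ordinal 3 0 isT))%:Z) (j - (m (@Ordinal 3 1 isT))%:Z)
        (k - (m (@Ordinal 3 2 isT))%:Z).
Proof.
rewrite (@poly_mul_widen _ [:: m]) //; last first.
  by move=> m' /msuppZ_le; rewrite msuppX.
by rewrite big_seq1 mcoeffZ mcoeffX eqxx mulr1.
Qed.

Lemma poly_mulX (m : 'X_{1..3}) (f : laurent) (i j k : int) :
  poly_mul 'X_[m] f i j k =
  f (i - (m (@Ordinal 3 0 isT))%:Z) (j - (m (@Ordinal 3 1 isT))%:Z)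
    (k - (m (@Ordinal 3 2 isT))%:Z).
Proof. by rewrite -['X_[m]]scale1r poly_mulZX mul1r. Qed.

Lemma poly_mul0 (f : laurent) (i j k : int) : poly_mul 0 f i j k = 0.
Proof. by rewrite /poly_mul msupp0 big_nil. Qed.

Lemma poly_mulZ (c : rat) (P : {mpoly rat[3]}) (f : laurent) (i j k : int) :
  poly_mul (c *: P) f i j k = c * poly_mul P f i j k.
Proof.
elim/mpolyind: P => [|a m P _ _ IH]; first by rewrite scaler0 poly_mul0 mulr0.
by rewrite scalerDr scalerA !poly_mulD !poly_mulZX IH mulrDr mulrA.
Qed.

Lemma poly_mulN (P : {mpoly rat[3]}) (f : laurent) (i j k : int) :
  poly_mul (- P) f i j k = - poly_mul P f i j k.
Proof. by rewrite -scaleN1r poly_mulZ mulN1r. Qed.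

Lemma poly_mul1 (f : laurent) (i j k : int) : poly_mul 1 f i j k = f i j k.
Proof. by rewrite -mpolyX0 poly_mulX !mnm0E !subr0. Qed.

Lemma poly_mul_sum (I : Type) (r : seq I) (p : pred I)
    (P : I -> {mpoly rat[3]}) (f : laurent) (i j k : int) :
  poly_mul (\sum_(s <- r | p s) P s) f i j k =
  \sum_(s <- r | p s) poly_mul (P s) f i j k.
Proof.
apply: (big_morph (fun Q => poly_mul Q f i j k)) => [P1 P2|].
  exact: poly_mulD.
exact: poly_mul0.
Qed.

Lemma poly_mul_ext (P : {mpoly rat[3]}) (f g : laurent) (i j k : int) :
  (forall i j k, f i j k = g i j k) -> poly_mul P f i j k = poly_mul P g i j k.
Proof. by move=> fg; apply: eq_bigr => m _; rewrite fg. Qed.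

Lemma poly_mul_mulX (m : 'X_{1..3}) (Q : {mpoly rat[3]}) (f : laurent)
    (i j k : int) :
  poly_mul ('X_[m] * Q) f i j k = poly_mul 'X_[m] (poly_mul Q f) i j k.
Proof.
elim/mpolyind: Q => [|c m' Q _ _ IH] in i j k *.
  by rewrite mulr0 poly_mulX !poly_mul0.
rewrite mulrDr poly_mulD IH !poly_mulX poly_mulD; congr (_ + _).
rewrite -scalerAr -mpolyXD !poly_mulZX !mnmDE !PoszD !opprD.
by rewrite !addrA.
Qed.

Lemma poly_mulA (P Q : {mpoly rat[3]}) (f : laurent) (i j k : int) :
  poly_mul (P * Q) f i j k = poly_mul P (poly_mul Q f) i j k.
Proof.
elim/mpolyind: P => [|c m P _ _ IH] in i j k *.
  by rewrite mul0r !poly_mul0.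
by rewrite mulrDl !poly_mulD IH -scalerAl !poly_mulZ poly_mul_mulX.
Qed.

Lemma poly_mulC (P Q : {mpoly rat[3]}) (f : laurent) (i j k : int) :
  poly_mul P (poly_mul Q f) i j k = poly_mul Q (poly_mul P f) i j k.
Proof. by rewrite -!poly_mulA mulrC. Qed.

Lemma poly_mulDr (P : {mpoly rat[3]}) (f g : laurent) (i j k : int) :
  poly_mul P (fun i j k => f i j k + g i j k) i j k =
  poly_mul P f i j k + poly_mul P g i j k.
Proof. by rewrite -big_split; apply: eq_bigr => m _; rewrite mulrDr. Qed.

(** * Expansions certified by multiplying out *)

Local Notation tofr := (@FracField.tofrac {mpoly rat[3]}).

(** Boundedness of the exponents is left out and checked once, on the final array. Without it F does
    not determine f, so a division requires the quotient array to be supplied. *)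
Definition expands (F : ratfun3) (f : laurent) : Prop :=
  exists P Q : {mpoly rat[3]},
    [/\ Q != 0, F = tofr P / tofr Q
      & forall i j k, poly_mul Q f i j k = poly_mul P laurent1 i j k].

Lemma expands_ext {F : ratfun3} {f : laurent} (g : laurent) :
  expands F f -> (forall i j k, f i j k = g i j k) -> expands F g.
Proof.
move=> [P [Q [Q0 FE fE]]] fg; exists P, Q; split=> // i j k.
by rewrite -fE; apply/esym/poly_mul_ext.
Qed.

Lemma expands1 : expands 1 laurent1.
Proof.
by exists 1, 1; split=> //; rewrite ?oner_eq0 // rmorph1 divr1.
Qed.

Lemma expandsD (F G : ratfun3) (f g : laurent) :
  expands F f -> expands G g ->
  expands (F + G) (fun i j k => f i j k + g i j k).
Proof.
move=> [P [Q [Q0 -> fE]]] [P' [Q' [Q0' -> gE]]].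
exists (P * Q' + P' * Q), (Q * Q'); split; first by rewrite mulf_neq0.
  by rewrite addf_div ?tofrac_eq0 // !rmorphD !rmorphM.
move=> i j k; rewrite poly_mulDr poly_mulD; congr (_ + _).
  rewrite [Q * Q']mulrC [P * Q']mulrC !poly_mulA.
  exact: poly_mul_ext.
by rewrite [P' * Q]mulrC !poly_mulA; apply: poly_mul_ext.
Qed.

Lemma expandsM (R : {mpoly rat[3]}) (F : ratfun3) (f : laurent) :
  expands F f -> expands (tofr R * F) (poly_mul R f).
Proof.
move=> [P [Q [Q0 -> fE]]]; exists (R * P), Q; split=> //.
  by rewrite mulrA rmorphM.
by move=> i j k; rewrite poly_mulC poly_mulA; apply: poly_mul_ext.
Qed.

Lemma expandsZ (c : rat) (F : ratfun3) (f : laurent) :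
  expands F f ->
  expands (tofr c%:MP * F) (fun i j k => c * f i j k).
Proof.
move/(expandsM c%:MP)/expands_ext; apply=> i j k.
by rewrite -(mulr1 c%:MP) mul_mpolyC poly_mulZ poly_mul1.
Qed.

Lemma expands_div (R : {mpoly rat[3]}) (F : ratfun3) (f h : laurent) :
  R != 0 -> expands F f -> (forall i j k, poly_mul R h i j k = f i j k) ->
  expands (F / tofr R) h.
Proof.
move=> R0 [P [Q [Q0 -> fE]]] hE; exists P, (Q * R); split.
- by rewrite mulf_neq0.
- by rewrite rmorphM /= invfM mulrA.
by move=> i j k; rewrite -fE poly_mulA; apply: poly_mul_ext.
Qed.

Lemma poly_mulXx (n : nat) (f : laurent) (i j k : int) :
  poly_mul ('X_(@Ordinal 3 0 isT) ^+ n) f i j k = f (i - n%:Z) j k.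
Proof.
by rewrite mpolyXn poly_mulX !mulmnE !mnm1E /= mul1n !mul0n !subr0.
Qed.

Lemma poly_mulXy (n : nat) (f : laurent) (i j k : int) :
  poly_mul ('X_(@Ordinal 3 1 isT) ^+ n) f i j k = f i (j - n%:Z) k.
Proof.
by rewrite mpolyXn poly_mulX !mulmnE !mnm1E /= mul1n !mul0n !subr0.
Qed.

Lemma poly_mulXt (f : laurent) (i j k : int) :
  poly_mul 'X_(@Ordinal 3 2 isT) f i j k = f i j (k - 1).
Proof. by rewrite poly_mulX !mnm1E /= !subr0. Qed.

Lemma mpolyX_neq0 (n : nat) (m : 'X_{1..n}) : 'X_[m] != 0 :> {mpoly rat[n]}.
Proof.
by apply/eqP => /mpolyP/(_ m)/eqP; rewrite mcoeffX mcoeff0 eqxx oner_eq0.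
Qed.

Lemma x3_neq0 : x3 != 0.
Proof. by rewrite tofrac_eq0 mpolyX_neq0. Qed.

Lemma y3_neq0 : y3 != 0.
Proof. by rewrite tofrac_eq0 mpolyX_neq0. Qed.

Lemma expands_x (p : int) (F : ratfun3) (f : laurent) :
  expands F f -> expands (x3 ^ p * F) (fun i j k => f (i - p) j k).
Proof.
move=> Ff; case: (intP p) => [|n|n].
- by rewrite expr0z mul1r; apply: (expands_ext _ Ff) => i j k; rewrite subr0.
- have := expandsM ('X_(@Ordinal 3 0 isT) ^+ n.+1) _ _ Ff.
  by rewrite rmorphXn => /expands_ext; apply=> i j k; rewrite poly_mulXx.
- rewrite -exprz_inv -exprnP exprVn mulrC -rmorphXn.
  apply: expands_div Ff _; first by rewrite expf_neq0 // mpolyX_neq0.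
  by move=> i j k; rewrite poly_mulXx opprK subrK.
Qed.

Lemma expands_y (p : int) (F : ratfun3) (f : laurent) :
  expands F f -> expands (y3 ^ p * F) (fun i j k => f i (j - p) k).
Proof.
move=> Ff; case: (intP p) => [|n|n].
- by rewrite expr0z mul1r; apply: (expands_ext _ Ff) => i j k; rewrite subr0.
- have := expandsM ('X_(@Ordinal 3 1 isT) ^+ n.+1) _ _ Ff.
  by rewrite rmorphXn => /expands_ext; apply=> i j k; rewrite poly_mulXy.
- rewrite -exprz_inv -exprnP exprVn mulrC -rmorphXn.
  apply: expands_div Ff _; first by rewrite expf_neq0 // mpolyX_neq0.
  by move=> i j k; rewrite poly_mulXy opprK subrK.
Qed.

(** * Counting quadrant walks by their last step *)

(** Integer end points are allowed so that the recurrence may look one step outside the quadrant,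
    where the count is zero. *)
Definition walk_count (St : stepset) (n : nat) (p : int * int) : nat :=
  #|[pred w : n.-tuple St | quadrant_walk w && (walk_point w n == p)]|.

Lemma walk_count_out (St : stepset) (n : nat) (p : int * int) :
  ~~ ((0 <= p.1) && (0 <= p.2)) -> walk_count St n p = 0%N.
Proof.
move=> np; apply: eq_card0 => w; rewrite !inE.
apply/negP => /andP[/forallP/(_ ord_max)] /=.
by move=> qw /eqP wp; move: np; rewrite -wp qw.
Qed.

Lemma walk_count0 (St : stepset) (p : int * int) :
  walk_count St 0 p = (p == 0) :> nat.
Proof.
rewrite /walk_count; set P := (X in #|X|).
have PE (w : 0.-tuple St) : w \in P = (p == 0).
  rewrite inE /walk_point take0 big_nil eq_sym /= andb_idl // => _.
  by apply/forallP => k; rewrite /walk_point tuple0 big_nil.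
have [p0|p0] := boolP (p == 0).
  rewrite (@eq_card _ _ predT) => [|w]; last by rewrite PE p0.
  by rewrite card_tuple expn0.
by apply: eq_card0 => w; rewrite PE (negbTE p0).
Qed.

Lemma walk_point_rcons (St : stepset) (n : nat) (w : n.-tuple St) (s : St)
    (k : nat) :
  (k <= n)%N -> walk_point (rcons_tuple w s) k = walk_point w k.
Proof.
move=> kn; rewrite /walk_point /= -cats1 take_cat size_tuple.
case: ltngtP kn => // -> _.
by rewrite subnn take0 cats0 take_oversize ?size_tuple.
Qed.

Lemma walk_point_rcons_last (St : stepset) (n : nat) (w : n.-tuple St)
    (s : St) :
  walk_point (rcons_tuple w s) n.+1 = walk_point w n + val s.
Proof.
rewrite /walk_point !take_oversize ?size_tuple //=.
by rewrite -cats1 big_cat big_seq1.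
Qed.

Lemma quadrant_walk_rcons (St : stepset) (n : nat) (w : n.-tuple St) (s : St) :
  quadrant_walk (rcons_tuple w s) =
  quadrant_walk w && (let p := walk_point w n + val s in
                      (0 <= p.1) && (0 <= p.2)).
Proof.
apply/forallP/andP => [q|[/forallP q ql] k].
  split; last by have := q ord_max; rewrite walk_point_rcons_last.
  apply/forallP => k; have := q (widen_ord (leqnSn _) k).
  by rewrite /= walk_point_rcons //; have := ltn_ord k.
case: (ltngtP k n.+1) => [kn|kn|->].
- by rewrite walk_point_rcons //; exact: (q (Ordinal kn)).
- by have := ltn_ord k; rewrite ltnNge kn.
- by rewrite walk_point_rcons_last.
Qed.

(** Removing the last step is a bijection. The one new condition, that the end point lies in the
    quadrant, is the hypothesis on [p]; for other [p] the left side is zero while the right side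
    need not be. *)
Lemma walk_countS (St : stepset) (n : nat) (p : int * int) :
  (0 <= p.1) && (0 <= p.2) ->
  walk_count St n.+1 p = (\sum_(s <- St) walk_count St n (p - s)%R)%N.
Proof.
move=> p0; rewrite big_seq_fsetE /= /walk_count -sum1_card.
pose h (ws : n.-tuple St * St) : n.+1.-tuple St := rcons_tuple ws.1 ws.2.
pose h' (w : n.+1.-tuple St) : n.-tuple St * St :=
  ([tuple of belast (thead w) (behead w)], last (thead w) (behead w)).
rewrite (reindex h) /=; last first.
  exists h' => [[w s] _|w _].
    rewrite /h' /h; congr pair; first apply/val_inj; rewrite /=.
      by case: w => -[|a w] //= sw; rewrite ?belast_rcons.
    by case: w => -[|a w] //= sw; rewrite ?last_rcons.
  apply/val_inj; rewrite /= -lastI; case: w => -[] //.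
rewrite (eq_bigr (fun s : St => \sum_(w : n.-tuple St |
    quadrant_walk w && (walk_point w n == (p - val s)%R)) 1)%N); last first.
  by move=> s _; rewrite -sum1_card.
rewrite (exchange_big_dep predT) //= pair_big_dep /=.
apply: eq_bigl => -[w s] /=; rewrite unfold_in /= quadrant_walk_rcons.
rewrite walk_point_rcons_last eq_sym -subr_eq [_ == walk_point _ _]eq_sym.
case: eqP => [->|]; last by rewrite !andbF.
by rewrite subrK /= p0 !andbT.
Qed.

(** * The recurrence satisfied by the coefficients of O S^n *)

Definition small_steps (l : seq (int * int)) : bool :=
  all (fun s => (s.1 \in [:: -1; 0; 1]) && (s.2 \in [:: -1; 0; 1])) l.

(** The coefficient of x^p y^q in G S^n, where [g0] holds the coefficients of G. Multiplying by S
    only adds finitely many shifts, so [g0] may have infinite support. *)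
Fixpoint step_iter (l : seq (int * int)) (g0 : int -> int -> rat) (n : nat)
    (p q : int) : rat :=
  if n is n'.+1 then \sum_(s <- l) step_iter l g0 n' (p - s.1) (q - s.2)
  else g0 p q.

(** The shift by one appears because the comparison is with xy C: the axes p = 0 and q = 0 stand for
    end points with a coordinate -1, where both sides vanish. From p, q >= 1 a small step leads back
    to indices >= 0, so the induction stays in the closed quadrant. *)
Lemma step_iter_walk_count (St : stepset) (g0 : int -> int -> rat) (n : nat)
    (p q : int) :
  small_steps St ->
  (forall p q, 1 <= p -> 1 <= q -> g0 p q = ((p == 1) && (q == 1))%:R) ->
  (forall n p, 0 <= p -> step_iter St g0 n p 0 = 0) ->
  (forall n q, 0 <= q -> step_iter St g0 n 0 q = 0) ->
  0 <= p -> 0 <= q ->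
  step_iter St g0 n p q = (walk_count St n (p - 1, q - 1))%:R.
Proof.
move=> /allP small g01 gp0 g0q; elim: n p q => [|n IH] p q p0 q0.
  have [->|pn0] := eqVneq p 0.
    by rewrite g0q // walk_count_out.
  have [->|qn0] := eqVneq q 0.
    by rewrite gp0 // walk_count_out // andbF.
  rewrite /= g01 ?walk_count0 /=; [|lia..].
  by rewrite -pair_eqE /= !subr_eq0.
have [->|pn0] := eqVneq p 0.
  by rewrite g0q // walk_count_out.
have [->|qn0] := eqVneq q 0.
  by rewrite gp0 // walk_count_out // andbF.
rewrite walk_countS /=; last by apply/andP; split; lia.
rewrite natr_sum; apply: eq_big_seq => -[s1 s2] /small.
rewrite !inE /= => ss.
rewrite IH; [|lia..].
congr (walk_count _ _ _)%:R.
by congr pair; rewrite /= addrAC.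
Qed.

Lemma walk_count_gt (St : stepset) (n : nat) (p : int * int) :
  small_steps St -> (n%:Z < p.1) || (n%:Z < p.2) -> walk_count St n p = 0%N.
Proof.
move=> /allP small; elim: n p => [|n IH] [p q] /=.
  rewrite walk_count0 -pair_eqE /= => pq.
  by have -> // : (p == 0) && (q == 0) = false by lia.
move=> pq; have [pq0|] := boolP ((0 <= p) && (0 <= q)); last first.
  by move=> np; apply: walk_count_out.
rewrite walk_countS // big_seq big1 // => -[s1 s2] /small.
rewrite !inE /= => ss; rewrite IH //=; lia.
Qed.

(** * Multiplication by 1/(1 - c x) *)

(** The coefficient of x^i in U(x)/(1 - c x) when U has no exponent below -D: terms with l > i + D
    vanish, so the sum may stop at |i| + D. *)
Definition geom_sum (D : nat) (c : rat) (u : int -> rat) (i : int) : rat :=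
  \sum_(l < `|i|%N + D + 1) c ^+ l * u (i - l%:Z).

Lemma geom_sum_widen (D N : nat) (c : rat) (u : int -> rat) (i : int) :
  (forall i, i < - D%:Z -> u i = 0) -> i + D%:Z < N%:Z ->
  geom_sum D c u i = \sum_(l < N) c ^+ l * u (i - l%:Z).
Proof.
move=> u0 iN; rewrite /geom_sum -!(big_mkord xpredT (fun l => c ^+ l * u (i - l%:Z))).
pose M := maxn N (`|i|%N + D + 1).
rewrite (@big_nat_widen _ _ _ 0 (`|i|%N + D + 1) M); last exact: leq_maxr.
rewrite [RHS](@big_nat_widen _ _ _ 0 N M); last exact: leq_maxl.
rewrite big_mkcond [RHS]big_mkcond; apply: eq_bigr => l _ /=.
case: ifP => lN; case: ifP => lM //.
  by rewrite u0 ?mulr0 //; lia.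
by rewrite u0 ?mulr0 //; lia.
Qed.

Lemma geom_sum_out (D : nat) (c : rat) (u : int -> rat) (i : int) :
  (forall i, i < - D%:Z -> u i = 0) -> i < - D%:Z -> geom_sum D c u i = 0.
Proof.
by move=> u0 iD; rewrite /geom_sum big1 // => l _; rewrite u0 ?mulr0 //; lia.
Qed.

Lemma geom_sumB (D : nat) (c : rat) (u : int -> rat) (i : int) :
  (forall i, i < - D%:Z -> u i = 0) ->
  geom_sum D c u i - c * geom_sum D c u (i - 1) = u i.
Proof.
move=> u0; pose N := (`|i|%N + D + 1)%N.
rewrite (@geom_sum_widen D N.+1) //; last by rewrite /N; lia.
rewrite (@geom_sum_widen D N) //; last by rewrite /N; lia.
rewrite big_ord_recl mul1r subr0 -addrA mulr_sumr -sumrB big1 ?addr0 // => l _.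
rewrite lift0 exprS -mulrA.
by rewrite (_ : i - l.+1%:Z = i - 1 - l%:Z) ?subrr //; lia.
Qed.

Lemma step_iter_support (l : seq (int * int)) (g0 : int -> int -> rat) (D n : nat)
    (p q : int) :
  small_steps l ->
  (forall p q, (D%:Z < p) || (D%:Z < q) -> g0 p q = 0) ->
  ((n + D)%N%:Z < p) || ((n + D)%N%:Z < q) -> step_iter l g0 n p q = 0.
Proof.
move=> /allP small g00; elim: n p q => [|n IH] p q; first exact: g00.
move=> pq; rewrite /= big_seq big1 // => -[s1 s2] /small.
by rewrite !inE /= => ss; apply: IH; lia.
Qed.

(** * The denominator 1 - t x y S(1/x, 1/y) *)

(** The polynomial x y S(1/x, 1/y): for small steps 1 - s is 0, 1 or 2, and the absolute value only
    makes it a natural number. *)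
Definition step_poly (St : stepset) : {mpoly rat[3]} :=
  \sum_(s <- St) 'X_(@Ordinal 3 0 isT) ^+ `|1 - s.1|%N
                 * 'X_(@Ordinal 3 1 isT) ^+ `|1 - s.2|%N.

Definition kernel_poly (St : stepset) : {mpoly rat[3]} :=
  1 - 'X_(@Ordinal 3 2 isT) * step_poly St.

Lemma kernel_poly_neq0 (St : stepset) : kernel_poly St != 0.
Proof.
apply/eqP => /(congr1 (meval (fun=> 0 : rat)))/eqP.
by rewrite /kernel_poly mevalB mevalM mevalXU mul0r subr0 meval1 meval0 oner_eq0.
Qed.

Lemma expr_absz (L : fieldType) (z : L) (s : int) :
  z != 0 -> s \in [:: -1; 0; 1] -> z ^+ `|1 - s|%N = z * z^-1 ^ s.
Proof.
rewrite !inE => z0 /or3P[]/eqP->; rewrite ?mulr1 //= ?expr1z ?mulfV //.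
by rewrite exprN1 invrK.
Qed.

Lemma kernel_polyE (St : stepset) : small_steps St ->
  FracField.tofrac (kernel_poly St) = 1 - t3 * x3 * y3 * charS St x3^-1 y3^-1.
Proof.
move=> /allP small; rewrite /kernel_poly rmorphB rmorph1 rmorphM /=.
rewrite -!mulrA; congr (1 - _ * _).
rewrite rmorph_sum !mulr_sumr /= !big_seq; apply: eq_bigr => -[s1 s2] /small.
move=> /andP[s1P s2P].
have xE n : FracField.tofrac ('X_(@Ordinal 3 0 isT) ^+ n) = x3 ^+ n :=
  rmorphXn _ _ _.
have yE n : FracField.tofrac ('X_(@Ordinal 3 1 isT) ^+ n) = y3 ^+ n :=
  rmorphXn _ _ _.
rewrite tofracM xE yE (expr_absz _ _ s1 x3_neq0 s1P) (expr_absz _ _ s2 y3_neq0 s2P).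
by rewrite mulrACA -mulrA.
Qed.

Lemma poly_mul_geom (i0 : 'I_3) (c : rat) (f : laurent) (i j k : int) :
  poly_mul (1 - c *: 'X_i0) f i j k = f i j k - c * poly_mul 'X_i0 f i j k.
Proof. by rewrite poly_mulD poly_mulN poly_mulZ poly_mul1. Qed.

Lemma geom_neq0 (i0 : 'I_3) (c : rat) : 1 - c *: 'X_i0 != 0 :> {mpoly rat[3]}.
Proof.
apply/eqP => /(congr1 (meval (fun=> 0 : rat)))/eqP.
by rewrite mevalB mevalZ mevalXU mulr0 subr0 meval1 meval0 oner_eq0.
Qed.

(** For a in {0, 1} the power (1 - x)^(-a) equals 1/(1 - a x), so one geometric sum of ratio a
    covers both values. *)
Lemma geomE (i0 : 'I_3) (a : nat) : (a <= 1)%N ->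
  (1 - FracField.tofrac 'X_i0) ^- a =
  (FracField.tofrac (1 - a%:R *: 'X_i0 : {mpoly rat[3]}))^-1.
Proof.
case: a => [|[|//]] _; first by rewrite scale0r subr0 rmorph1.
by rewrite scale1r rmorphB rmorph1.
Qed.

(** * Reading the walk counts off the diagonal *)

(** The coefficient of x^n y^n after division by (1 - a x)(1 - b y) adds up, with weights a^i b^j,
    the coefficients of x^(n-i) y^(n-j), and these count the walks ending at (i, j). For a = 0 the
    weight 0^i keeps only i = 0. *)
Lemma is_diagonal_step_iter (St : stepset) (g0 : int -> int -> rat) (D : nat)
    (F0 : ratfun3) (a b : nat) :
  (a <= 1)%N -> (b <= 1)%N ->
  small_steps St ->
  expands F0 (fun i j k => (k == 0)%:R * g0 (1 - i) (1 - j)) ->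
  (forall p q, (D%:Z < p) || (D%:Z < q) -> g0 p q = 0) ->
  (forall p q, 1 <= p -> 1 <= q -> g0 p q = ((p == 1) && (q == 1))%:R) ->
  (forall n p, 0 <= p -> step_iter St g0 n p 0 = 0) ->
  (forall n q, 0 <= q -> step_iter St g0 n 0 q = 0) ->
  is_diagonal (F0 / (1 - t3 * x3 * y3 * charS St x3^-1 y3^-1)
                * ((1 - x3) ^- a * (1 - y3) ^- b))
              (walk_gf St a%:R b%:R).
Proof.
move=> a1 b1 small F0E g0D g01 gp0 g0q.
(* With F0 = x y O(1/x, 1/y), the coefficient of t^n in F0 / (1 - t x y S(1/x, 1/y)) is F0 (x y
   S(1/x, 1/y))^n; its x^i y^j coefficient is that of x^(n+1-i) y^(n+1-j) in O S^n. *)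
pose h : laurent := fun i j k =>
  if k is Posz n then step_iter St g0 n (n%:Z + 1 - i) (n%:Z + 1 - j) else 0.
pose h1 : laurent := fun i j k => geom_sum D a%:R (fun i => h i j k) i.
pose h2 : laurent := fun i j k => geom_sum D b%:R (fun j => h1 i j k) j.
have h0 i j k : (i < - D%:Z) || (j < - D%:Z) -> h i j k = 0.
  case: k => // n ij; apply: (@step_iter_support _ _ D) => //; lia.
have h0i j k i : i < - D%:Z -> h i j k = 0 by move=> iD; rewrite h0 // iD.
have h1j i k j : j < - D%:Z -> h1 i j k = 0.
  by move=> jD; rewrite /h1 /geom_sum big1 // => l _; rewrite h0 ?jD ?orbT ?mulr0.
exists h2.
  split.
    exists (- D%:Z) => i j k h2n0.
    have jD : - D%:Z <= j.
      rewrite leNgt; apply/negP => jD; move/eqP: h2n0; apply.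
      by rewrite /h2 geom_sum_out // => j'; apply: h1j.
    have iD : - D%:Z <= i.
      rewrite leNgt; apply/negP => iD; move/eqP: h2n0; apply.
      rewrite /h2 /geom_sum big1 // => l _.
      by rewrite /h1 geom_sum_out ?mulr0 // => i'; apply: h0i.
    rewrite iD jD /=; case: k h2n0 => [k|k]; first lia.
    rewrite /h2 /geom_sum big1 ?eqxx // => l _.
    by rewrite /h1 /geom_sum big1 ?mulr0 // => m _; rewrite mulr0.
  rewrite mulrA !geomE // -kernel_polyE //.
  apply: (@expands_div _ _ h1) (geom_neq0 _ _) _ _.
    apply: (@expands_div _ _ h) (geom_neq0 _ _) _ _.
      apply: expands_div (kernel_poly_neq0 _) F0E _ => i j k.
      rewrite poly_mulD poly_mul1 poly_mulN poly_mulA poly_mulXt poly_mul_sum.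
      under eq_bigr do rewrite poly_mulA poly_mulXx poly_mulXy.
      case: k => [[|n]|n].
      - by rewrite big1 // subr0 mul1r; congr g0; lia.
      - rewrite mul0r (_ : n.+1%:Z - 1 = n%:Z); last lia.
        apply/eqP; rewrite subr_eq0; apply/eqP.
        rewrite /= !big_seq; apply: eq_bigr => -[s1 s2] /(allP small).
        by rewrite !inE /= => ss; congr step_iter; lia.
      - rewrite mul0r (_ : Negz n - 1 = Negz n.+1); last lia.
        by rewrite big1 // subr0.
    move=> i j k; rewrite poly_mul_geom -['X_ _]expr1 poly_mulXx.
    by apply: geom_sumB => i'; apply: h0i.
  move=> i j k; rewrite poly_mul_geom -['X_ _]expr1 poly_mulXy.
  by apply: geom_sumB => j'; apply: h1j.
move=> n; rewrite /h2 (@geom_sum_widen D (n + D).+1); last 2 first.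
- by move=> j'; apply: h1j.
- lia.
(* The geometric sums run up to n + D. Beyond n they meet only end points with a coordinate above n,
   which no walk of length n reaches. *)
have sumE (u : nat -> rat) : (forall i, (n < i)%N -> u i = 0) ->
    \sum_(i < (n + D).+1) u i = \sum_(i < n.+1) u i.
  move=> u0; rewrite -(big_mkord xpredT u) -(big_mkord xpredT u).
  rewrite [RHS](@big_nat_widen _ _ _ 0 n.+1 (n + D).+1); last lia.
  rewrite [RHS]big_mkcond; apply: eq_bigr => i _ /=.
  by case: ifP => // /negbT; rewrite -ltnNge => ?; rewrite u0.
have hE (i j : nat) : h (n%:Z - i%:Z) (n%:Z - j%:Z) n%:Z = (nb_walks St i j n)%:R.
  rewrite /h (_ : n%:Z + 1 - (n%:Z - i%:Z) = i%:Z + 1); last lia.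
  rewrite (_ : n%:Z + 1 - (n%:Z - j%:Z) = j%:Z + 1); last lia.
  by rewrite step_iter_walk_count ?addrK.
rewrite /walk_gf exchange_big /=.
rewrite -(sumE (fun j => \sum_(i < n.+1)
  (nb_walks St i j n)%:R * a%:R ^+ i * b%:R ^+ j)); last first.
  move=> j nj; rewrite big1 // => i _; rewrite [nb_walks _ _ _ _]walk_count_gt //=.
    by rewrite !mul0r.
    by apply/orP; right; rewrite ltz_nat.
apply: eq_bigr => j _; rewrite /h1 (@geom_sum_widen D (n + D).+1); last 2 first.
- by move=> i'; apply: h0i.
- lia.
rewrite -(sumE (fun i => (nb_walks St i j n)%:R * a%:R ^+ i * b%:R ^+ j)); last first.
  move=> i ni; rewrite [nb_walks _ _ _ _]walk_count_gt //= ?mul0r //.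
  by rewrite ltz_nat ni.
rewrite mulr_sumr; apply: eq_bigr => i _.
by rewrite hE mulrC [a%:R ^+ i * _]mulrC.
Qed.

(** * Antisymmetry and vanishing on the axes *)

Lemma step_iter_perm (l l' : seq (int * int)) (g0 : int -> int -> rat) (n : nat)
    (p q : int) :
  perm_eq l l' -> step_iter l g0 n p q = step_iter l' g0 n p q.
Proof.
move=> ll'; elim: n p q => [//|n IH] p q /=.
by rewrite (perm_big _ ll') /=; apply: eq_bigr => s _; rewrite IH.
Qed.

(** A map of exponents that respects differences and permutes the steps leaves S invariant, so its
    sign change passes from G to every G S^n. At a fixed point the coefficient is then its own
    negative. *)
Lemma step_iter_antisym (l : seq (int * int)) (g0 : int -> int -> rat)
    (phi : int * int -> int * int) (n : nat) (p : int * int) :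
  {morph phi : u v / u - v} -> perm_eq (map phi l) l ->
  (forall p, g0 (phi p).1 (phi p).2 = - g0 p.1 p.2) ->
  step_iter l g0 n (phi p).1 (phi p).2 = - step_iter l g0 n p.1 p.2.
Proof.
move=> phiB phil g0phi; elim: n p => [|n IH] p /=; first exact: g0phi.
rewrite -(perm_big _ phil) big_map /= -sumrN; apply: eq_bigr => s _.
by have := IH (p - s); rewrite phiB.
Qed.

(** Multiplication by A_k(x) on a sequence of coefficients in x. *)
Definition row_op (l : seq (int * int)) (k : int) (u : int -> rat) (p : int) :
    rat :=
  \sum_(s <- l | s.2 == k) u (p - s.1).

Lemma step_iterS_row (l : seq (int * int)) (g0 : int -> int -> rat) (n : nat)
    (p q : int) : small_steps l ->
  step_iter l g0 n.+1 p q =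
  row_op l (-1) (fun p => step_iter l g0 n p (q + 1)) p
  + row_op l 0 (fun p => step_iter l g0 n p q) p
  + row_op l 1 (fun p => step_iter l g0 n p (q - 1)) p.
Proof.
move=> /allP small; rewrite /= /row_op.
rewrite big_mkcond [X in _ = X + _ + _]big_mkcond [X in _ = _ + X + _]big_mkcond.
rewrite [X in _ = _ + _ + X]big_mkcond -!big_split /=.
apply: eq_big_seq => -[s1 s2] /small; rewrite !inE /= => /andP[_].
by case/or3P => /eqP -> /=; rewrite ?add0r ?addr0 ?opprK ?subr0.
Qed.

Lemma row_opC (l : seq (int * int)) (k k' : int) (u : int -> rat) :
  row_op l k (row_op l k' u) = row_op l k' (row_op l k u).
Proof.
apply: funext => p; rewrite /row_op exchange_big /=.
by apply: eq_bigr => s _; apply: eq_bigr => s' _; rewrite addrAC.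
Qed.

Lemma iter_row_opC (l : seq (int * int)) (m : nat) (k k' : int)
    (u : int -> rat) :
  iter m (row_op l k) (row_op l k' u) = row_op l k' (iter m (row_op l k) u).
Proof. by elim: m => //= m ->; rewrite row_opC. Qed.

Lemma row_opD (l : seq (int * int)) (k : int) (u v : int -> rat) :
  row_op l k (fun p => u p + v p) = fun p => row_op l k u p + row_op l k v p.
Proof. by apply: funext => p; rewrite /row_op big_split. Qed.

Lemma row_opN (l : seq (int * int)) (k : int) (u : int -> rat) :
  row_op l k (fun p => - u p) = fun p => - row_op l k u p.
Proof. by apply: funext => p; rewrite /row_op sumrN. Qed.

Lemma row_op0 (l : seq (int * int)) (k : int) :
  row_op l k (fun=> 0) = fun=> 0.
Proof. by apply: funext => p; rewrite /row_op big1. Qed.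

Lemma iter_row_opD (l : seq (int * int)) (m : nat) (k : int)
    (u v : int -> rat) :
  iter m (row_op l k) (fun p => u p + v p) =
  fun p => iter m (row_op l k) u p + iter m (row_op l k) v p.
Proof. by elim: m => //= m ->; rewrite row_opD. Qed.

Lemma iter_row_op0 (l : seq (int * int)) (m : nat) (k : int) :
  iter m (row_op l k) (fun=> 0) = fun=> 0.
Proof. by elim: m => //= m ->; rewrite row_op0. Qed.

(* Invariance of S under y -> A_{-1} / (A_1 y): the row generating functions
   G_q satisfy A_1^q G_{-q} = - A_{-1}^q G_q, whence G_0 = 0. *)
Lemma step_iter_rows (l : seq (int * int)) (g0 : int -> int -> rat) (n m : nat) :
  small_steps l ->
  (forall m : nat, iter m (row_op l 1) (g0^~ (- m%:Z)) =
    fun p => - iter m (row_op l (-1)) (g0^~ m%:Z) p) ->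
  iter m (row_op l 1) (fun p => step_iter l g0 n p (- m%:Z)) =
  fun p => - iter m (row_op l (-1)) (fun p => step_iter l g0 n p m%:Z) p.
Proof.
move=> small base; elim: n m => [|n IH] m; first exact: base.
(* For m = 0 the induction hypothesis reads G_0 = - G_0. *)
have G0 : (fun p => step_iter l g0 n p 0) = fun=> 0.
  apply: funext => p; have := congr1 (@^~ p) (IH 0%N); rewrite /=.
  by rewrite oppr0 => h; lra.
have rowE q : (fun p => step_iter l g0 n.+1 p q) = fun p =>
    row_op l (-1) (fun p => step_iter l g0 n p (q + 1)) p
    + row_op l 0 (fun p => step_iter l g0 n p q) p
    + row_op l 1 (fun p => step_iter l g0 n p (q - 1)) p.
  by apply: funext => p; rewrite step_iterS_row.
rewrite !rowE.
case: m => [|m].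
  have := IH 1%N; rewrite /= !oppr0 !add0r => ->.
  by rewrite G0 row_op0; apply: funext => p; rewrite addr0 addrN oppr0.
rewrite !iter_row_opD !iter_row_opC.
rewrite (_ : - m.+1%:Z + 1 = - m%:Z); last lia.
rewrite (_ : - m.+1%:Z - 1 = - m.+2%:Z); last lia.
rewrite (_ : m.+1%:Z + 1 = m.+2%:Z); last lia.
rewrite (_ : m.+1%:Z - 1 = m%:Z); last lia.
(* After multiplication by A_1^(m+1) the outer terms trade places: the one from row -m becomes - A_1
   A_{-1}^(m+1) G_m, the one from row -(m+2) becomes - A_{-1}^(m+2) G_(m+2). *)
have := IH m.+2; rewrite [iter m.+2 _ _]iterS => ->.
rewrite IH [iter m.+1 _ (fun p => step_iter l g0 n p (- m%:Z))]iterS IH.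
rewrite !row_opN; apply: funext => p.
by rewrite !iterS [in LHS]row_opC; ring.
Qed.

(** Restricted to q >= 0, since below it [g0] may hold an expansion in 1/x that x -> 1/x does not
    preserve. As row 0 vanishes and rows q >= 1 refer only to rows q >= 0, the sign change
    propagates without the lower half-plane. *)
Lemma step_iter_flip (l : seq (int * int)) (g0 : int -> int -> rat) (n : nat)
    (p q : int) :
  small_steps l -> perm_eq (map (fun s => (- s.1, s.2)) l) l ->
  (forall n p, step_iter l g0 n p 0 = 0) ->
  (forall p q, 1 <= q -> g0 (- p) q = - g0 p q) ->
  0 <= q -> step_iter l g0 n (- p) q = - step_iter l g0 n p q.
Proof.
move=> /allP small flip gp0 g0flip; elim: n p q => [|n IH] p q q0.
  have [->|qn0] := eqVneq q 0; first by rewrite !gp0 oppr0.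
  by apply: g0flip; lia.
have [->|qn0] := eqVneq q 0; first by rewrite !gp0 oppr0.
rewrite [LHS]/= -(perm_big _ flip) big_map /= -sumrN.
apply: eq_big_seq => -[s1 s2] /small; rewrite !inE /= => ss.
by rewrite opprK -IH ?opprB 1?addrC //; lia.
Qed.

(** A_1 is 1, x + 1/x or 1 + x + 1/x: the nonempty choices invariant under x -> 1/x. *)
Definition upper_row_shapes : seq (seq int) := [:: [:: 0]; [:: 1; -1]; [:: 0; 1; -1]].

Definition upper_row (l : seq (int * int)) : seq int :=
  [seq s.1 | s <- l & s.2 == 1].

(** The expansion of 1/A_1 at infinity. For A_1 = x + beta + 1/x it is the sum of the c_n x^(-n)
    with c_0 = 0, c_1 = 1 and c_(n+2) = - c_n - beta c_(n+1). *)
Lemma row_op_inverse (l : seq (int * int)) :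
  has (perm_eq (upper_row l)) upper_row_shapes ->
  exists2 e : int -> rat, (forall p, 0 < p -> e p = 0)
    & forall p, row_op l 1 e p = (p == 0)%:R.
Proof.
move=> /hasP[s sS sE].
have rowE u p : row_op l 1 u p = \sum_(x <- s) u (p - x).
  by rewrite -(perm_big _ sE) big_map big_filter.
have [c [c0 c1 cSS]] : exists c : rat -> nat -> rat,
    [/\ forall beta, c beta 0%N = 0, forall beta, c beta 1%N = 1 &
      forall beta n, c beta n.+2 = - c beta n - beta * c beta n.+1].
  (* The iteration carries the pair (c_n, c_(n+1)). *)
  by exists (fun beta n =>
    (iter n (fun ab => (ab.2, - ab.1 - beta * ab.2)) (0, 1)).1).
pose e (beta : rat) (p : int) : rat := if 0 < p then 0 else c beta (absz p).
have eE (beta : rat) (p : int) : e beta (p - 1) + beta * e beta p + e beta (p + 1) = (p == 0)%:R.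
  rewrite /e; case: (ltrgt0P p) => [p0|p0|->].
  - have -> : 0 < p + 1 by lia.
    have [p1|p1] := boolP (0 < p - 1); first by rewrite mulr0 !addr0.
    have -> : p = 1 by lia.
    by rewrite subrr /= c0 mulr0 !addr0.
  - have -> : (0 < p - 1) = false by lia.
    have -> : (0 < p + 1) = false by lia.
    have -> : absz (p - 1) = (absz (p + 1)).+2 by lia.
    have -> : absz p = (absz (p + 1)).+1 by lia.
    by rewrite cSS /=; ring.
  - by rewrite /= c0 c1 mulr0 !addr0.
move: sS rowE {sE}; rewrite !inE => /or3P[]/eqP -> rowE.
- exists (fun p => (p == 0)%:R) => [p p0|p]; first by case: eqP => //; lia.
  by rewrite rowE big_seq1 subr0.
- exists (e 0) => [p p0|p]; first by rewrite /e p0.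
  by rewrite rowE !big_cons big_nil addr0 opprK -(eE 0) mul0r addr0.
- exists (e 1) => [p p0|p]; first by rewrite /e p0.
  rewrite rowE !big_cons big_nil addr0 subr0 opprK -(eE 1) mul1r.
  by rewrite addrCA addrA.
Qed.

(** * Evaluating rational functions *)

Lemma pi_ratio_mul (R : idomainType) (z : {ratio R}) (n d : R) :
  \n_z * d = \d_z * n ->
  (\pi_({fraction R}) z)%qT * FracField.tofrac d = FracField.tofrac n.
Proof.
move=> zE; apply/eqP; rewrite !piE /FracField.equivf /FracField.mulf.
by rewrite !numden_Ratio ?oner_eq0 ?mulr1 ?denom_ratioP // zE.
Qed.

(** This links F to the representative through which [ratfun_eval] is defined. *)
Lemma tofrac_repr (R : idomainType) (F : {fraction R}) :
  F = FracField.tofrac \n_(repr F) / FracField.tofrac \d_(repr F).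
Proof.
apply: (canRL (mulfK _)); first by rewrite tofrac_eq0 denom_ratioP.
by rewrite -{1}[F]reprK; apply: pi_ratio_mul; rewrite mulrC.
Qed.

Section Evaluation.
Context {K : fieldType} (ev : {rmorphism {mpoly rat[2]} -> K}).
Local Notation tofr := (@FracField.tofrac {mpoly rat[2]}).

(** A relation, because [ev] may send a denominator to zero and some fraction for F has to survive.
    It serves at (1/x, 1/y), where every fraction survives, and at rational points, where this must
    be checked. *)
Definition evaluates (F : ratfun2) (c : K) : Prop :=
  exists P Q : {mpoly rat[2]},
    [/\ ev Q != 0, F = tofr P / tofr Q & c = ev P / ev Q].

Lemma ev_neq0 (Q : {mpoly rat[2]}) : ev Q != 0 -> Q != 0.
Proof. by apply: contraNneq => ->; rewrite rmorph0. Qed.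

Lemma evaluates_fun (F : ratfun2) (c c' : K) :
  evaluates F c -> evaluates F c' -> c = c'.
Proof.
move=> [P [Q [Q0 -> ->]]] [P' [Q' [Q0' FE ->]]].
apply/eqP; rewrite eqr_div //; move/eqP: FE.
rewrite eqr_div ?tofrac_eq0 ?ev_neq0 // -!tofracM tofrac_eq => /eqP PQ.
by rewrite -!rmorphM PQ.
Qed.

Lemma evaluates_poly (P : {mpoly rat[2]}) : evaluates (tofr P) (ev P).
Proof. by exists P, 1; rewrite !rmorph1 !divr1 oner_eq0. Qed.

Lemma evaluatesD (F G : ratfun2) (c d : K) :
  evaluates F c -> evaluates G d -> evaluates (F + G) (c + d).
Proof.
move=> [P [Q [Q0 -> ->]]] [P' [Q' [Q0' -> ->]]].
exists (P * Q' + P' * Q), (Q * Q').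
rewrite !addf_div ?tofrac_eq0 ?ev_neq0 // !rmorphD !rmorphM.
by split=> //; rewrite mulf_neq0.
Qed.

Lemma evaluatesM (F G : ratfun2) (c d : K) :
  evaluates F c -> evaluates G d -> evaluates (F * G) (c * d).
Proof.
move=> [P [Q [Q0 -> ->]]] [P' [Q' [Q0' -> ->]]].
exists (P * P'), (Q * Q'); rewrite !mulf_div !rmorphM.
by split=> //; rewrite mulf_neq0.
Qed.

Lemma evaluatesV (F : ratfun2) (c : K) :
  c != 0 -> evaluates F c -> evaluates F^-1 c^-1.
Proof.
move=> c0 [P [Q [Q0 -> cE]]]; exists Q, P; rewrite cE !invf_div; split=> //.
by apply: contraNneq c0; rewrite cE => ->; rewrite mul0r.
Qed.

Lemma evaluates1 : evaluates 1 1.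
Proof. by have := evaluates_poly 1; rewrite !rmorph1. Qed.

Lemma evaluatesN1 (n : nat) : evaluates ((-1) ^+ n) ((-1) ^+ n).
Proof. by have := evaluates_poly ((-1) ^+ n); rewrite !rmorphXn !rmorphN1. Qed.

Lemma evaluatesX (F : ratfun2) (c : K) (n : nat) :
  evaluates F c -> evaluates (F ^+ n) (c ^+ n).
Proof.
move=> Fc; elim: n => [|n IH]; first exact: evaluates1.
by rewrite !exprS; apply: evaluatesM.
Qed.

Lemma evaluatesXz (F : ratfun2) (c : K) (n : int) :
  c != 0 -> evaluates F c -> evaluates (F ^ n) (c ^ n).
Proof.
move=> c0 Fc; case: n => n; first exact: evaluatesX.
by rewrite !NegzE -!invr_expz; apply: evaluatesV; rewrite ?expf_neq0 //; apply: evaluatesX.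
Qed.

Lemma evaluates_sum (I : Type) (r : seq I) (p : pred I) (F : I -> ratfun2)
    (c : I -> K) :
  (forall i, p i -> evaluates (F i) (c i)) ->
  evaluates (\sum_(i <- r | p i) F i) (\sum_(i <- r | p i) c i).
Proof.
move=> Fc; apply: (big_ind2 evaluates) => //; last by move=> *; apply: evaluatesD.
by have := evaluates_poly 0; rewrite !rmorph0.
Qed.

Lemma evaluates_charA (St : stepset) (k : int) (F : ratfun2) (c : K) :
  c != 0 -> evaluates F c -> evaluates (charA St k F) (charA St k c).
Proof. by move=> c0 Fc; apply: evaluates_sum => s _; apply: evaluatesXz. Qed.

Lemma evaluates_charB (St : stepset) (k : int) (F : ratfun2) (c : K) :
  c != 0 -> evaluates F c -> evaluates (charB St k F) (charB St k c).
Proof. by move=> c0 Fc; apply: evaluates_sum => s _; apply: evaluatesXz. Qed.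

End Evaluation.

Section Substitution.
Variables u v : ratfun3.

Definition subst_val (i : 'I_2) : ratfun3 := if val i == 0%N then u else v.

Definition subst_poly : {mpoly rat[2]} -> ratfun3 :=
  mmap (@FracField.tofrac _ \o @mpolyC 3 rat) subst_val.

HB.instance Definition _ := GRing.RMorphism.on subst_poly.

Lemma subst_poly_x : subst_poly 'X_(@Ordinal 2 0 isT) = u.
Proof. by rewrite /subst_poly mmapX mmap1U. Qed.

Lemma subst_poly_y : subst_poly 'X_(@Ordinal 2 1 isT) = v.
Proof. by rewrite /subst_poly mmapX mmap1U. Qed.

End Substitution.

Lemma expr_subn (K : fieldType) (z : K) (n k : nat) : z != 0 -> (k <= n)%N ->
  z ^+ n * z^-1 ^+ k = z ^+ (n - k).
Proof.
by move=> z0 kn; rewrite -{1}(subnK kn) exprD exprVn mulfK // expf_neq0.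
Qed.

Definition inv_poly : {mpoly rat[2]} -> ratfun3 := subst_poly x3^-1 y3^-1.

HB.instance Definition _ := GRing.RMorphism.on inv_poly.

(** Multiplication by (x y)^N reverses the exponents and turns P(1/x, 1/y) into a polynomial [R]
    with the coefficients of P. This is the algebraic independence of 1/x and 1/y, which frees
    [ratfun_eval] there from the choice of representative. *)
Lemma inv_poly_inj (P : {mpoly rat[2]}) : inv_poly P = 0 -> P = 0.
Proof.
pose N := msize P; pose i0 := @Ordinal 2 0 isT; pose i1 := @Ordinal 2 1 isT.
pose j0 := @Ordinal 3 0 isT; pose j1 := @Ordinal 3 1 isT.
pose mu (m : 'X_{1..2}) : 'X_{1..3} :=
  (U_(j0) *+ (N - m i0)%N + U_(j1) *+ (N - m i1)%N)%MM.
pose R : {mpoly rat[3]} := \sum_(m <- msupp P) P@_m *: 'X_[mu m].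
have mN m i : m \in msupp P -> (m i <= N)%N.
  move=> mP; apply: leq_trans (ltnW (msize_mdeg_lt mP)).
  by rewrite mdegE (bigD1 i) //= leq_addr.
have muI m m' : m \in msupp P -> m' \in msupp P -> mu m = mu m' -> m = m'.
  move=> mP mP' /mnmP muE; apply/mnmP => i.
  have := muE j0; have := muE j1; rewrite !mnmDE !mulmnE !mnm1E /=.
  rewrite !mul1n !mul0n !addn0 !add0n.
  have := mN m i mP; have := mN m' i mP'.
  have [->|->] : i = i0 \/ i = i1.
    by case: i => -[|[|//]] ?; [left|right]; apply: val_inj.
    by lia.
  by lia.
move=> evP; have R0 : R = 0.
  apply/eqP; rewrite -tofrac_eq0; apply/eqP.
  rewrite -(mulr0 ((x3 * y3) ^+ N)) -evP /inv_poly /subst_poly /mmap.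
  rewrite mulr_sumr rmorph_sum /= !big_seq; apply: eq_bigr => m mP.
  rewrite -mul_mpolyC tofracM [RHS]mulrCA; congr (_ * _).
  rewrite /mmap1 !big_ord_recl big_ord0 mulr1 exprMn /subst_val /=.
  rewrite (_ : ord0 = i0); last exact: val_inj.
  rewrite (_ : lift i0 ord0 = i1); last exact: val_inj.
  rewrite mulrACA (expr_subn _ _ _ _ x3_neq0 (mN m i0 mP)).
  rewrite (expr_subn _ _ _ _ y3_neq0 (mN m i1 mP)).
  by rewrite mpolyXD -!mpolyXn tofracM !tofracXn.
apply/mpolyP => m; rewrite mcoeff0.
have [mP|/memN_msupp_eq0//] := boolP (m \in msupp P).
have := congr1 (mcoeff (mu m)) R0; rewrite mcoeff0 raddf_sum /=.
rewrite (bigD1_seq m) ?msupp_uniq //= big_seq_cond big1 ?addr0.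
  by rewrite mcoeffZ mcoeffX eqxx mulr1.
move=> m' /andP[mP' mm']; rewrite mcoeffZ mcoeffX.
case: eqP => [/muI|]; last by rewrite mulr0.
by move=> /(_ mP' mP) m'E; rewrite m'E eqxx in mm'.
Qed.

Lemma ratfun_evalE (F : ratfun2) (c : ratfun3) :
  evaluates inv_poly F c -> ratfun_eval F x3^-1 y3^-1 = c.
Proof.
apply: evaluates_fun; exists \n_(repr F), \d_(repr F); split=> //.
  apply/eqP => /inv_poly_inj /eqP; apply/negP; exact: denom_ratioP.
exact: tofrac_repr.
Qed.

Lemma evaluates_inv_x2 : evaluates inv_poly x2 x3^-1.
Proof.
have := evaluates_poly inv_poly 'X_(@Ordinal 2 0 isT).
by rewrite /= /inv_poly subst_poly_x.
Qed.

Lemma evaluates_inv_y2 : evaluates inv_poly y2 y3^-1.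
Proof.
have := evaluates_poly inv_poly 'X_(@Ordinal 2 1 isT).
by rewrite /= /inv_poly subst_poly_y.
Qed.

(** * Orbits that close up into a cycle *)

Lemma uniq_map_iota_inj (T : eqType) (f : nat -> T) (n k k' : nat) :
  uniq [seq f k | k <- iota 0 n] -> (k < n)%N -> (k' < n)%N ->
  f k = f k' -> k = k'.
Proof.
move=> uf kn kn' fkk'; apply/eqP.
have nthE i : (i < n)%N -> nth (f 0%N) [seq f k | k <- iota 0 n] i = f i.
  by move=> im; rewrite (nth_map 0%N) ?size_iota // nth_iota.
by rewrite -(nth_uniq (f 0%N) _ _ uf) ?size_map ?size_iota // !nthE // fkk'.
Qed.

(** The orbit is a cycle of length 2m, position k being reached by k alternating reflections
    starting with Phi. Phi exchanges 2j and 2j+1; Psi exchanges 2j-1 and 2j, with 2m-1 and 0 as the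
    pair that closes the cycle. *)
Definition Phi_index (k : nat) : nat := if odd k then k.-1 else k.+1.

Definition Psi_index (m k : nat) : nat :=
  if odd k then (if k == (m.*2).-1 then 0 else k.+1)%N
  else (if k == 0 then (m.*2).-1 else k.-1)%N.

(** Each reflection changes the parity of the position, so every word for [e k] has length of the
    parity of k, and the sign follows without computing the minimal length. *)
Lemma orbit_sum_cycle (St : stepset) (m : nat) (e : nat -> birat) :
  (0 < m)%N -> e 0%N = (x2, y2) ->
  (forall k, (k < m.*2)%N -> Phi St (e k) = e (Phi_index k)) ->
  (forall k, (k < m.*2)%N -> Psi St (e k) = e (Psi_index m k)) ->
  uniq [seq e k | k <- iota 0 m.*2] ->
  orbit_sum St = \sum_(k <- iota 0 m.*2) (-1) ^+ k * ((e k).1 * (e k).2).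
Proof.
move=> m0 e0 ePhi ePsi ue.
pose idx (w : seq bool) : nat :=
  foldr (fun b k => if b then Phi_index k else Psi_index m k) 0%N w.
have idxP w : (idx w < m.*2)%N /\ odd (idx w) = odd (size w).
  elim: w => [|b w [lt_w odd_w]]; first by rewrite /= double_gt0.
  rewrite /= -odd_w; case: b; rewrite /= /Phi_index /Psi_index.
    by case: ifP => ow; lia.
  by case: ifP => ow; case: ifP => kw; split; lia.
have mapE w : word_map St w = e (idx w).
  elim: w => [|b w IH] //=; rewrite -/(word_map St w) IH.
  by case: b; rewrite ?ePhi ?ePsi ?(idxP w).1.
have eI := @uniq_map_iota_inj _ e m.*2 _ _ ue.
have reach k : (k < m.*2)%N -> exists w, word_map St w = e k.
  elim: k => [_|k IH km]; first by exists [::].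
  (* The letter [~~ odd k] moves position k to k + 1: Phi from even positions, Psi from odd ones. *)
  have [w wE] := IH (ltnW km); exists (~~ odd k :: w).
  rewrite /= -/(word_map St w) wE; case: (boolP (odd k)) => /= ok.
    by rewrite ePsi ?(ltnW km) // /Psi_index ok ifF //; lia.
  by rewrite ePhi ?(ltnW km) // /Phi_index (negbTE ok).
have sgnE k : (k < m.*2)%N -> (-1) ^+ group_length St (e k) = (-1) ^+ k :> ratfun2.
  move=> km; rewrite /group_length; case: pselect => [h|nh]; last first.
    have [w wE] := reach k km; case: nh; exists (size w).
    by apply/existsP; exists (in_tuple w); rewrite /= wE.
  case: ex_minnP => n /existsP[w /eqP]; rewrite mapE => wE _.
  have wk := eI _ _ (idxP w).1 km wE.
  by rewrite -signr_odd -[RHS]signr_odd -wk (idxP w).2 size_tuple.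
have groupE : walk_group St = [set` [seq e k | k <- iota 0 m.*2]]%classic.
  apply/seteqP; split=> g /=.
    move=> [w <-]; rewrite mapE map_f // mem_iota; exact: (idxP w).1.
  move=> /mapP[k]; rewrite mem_iota => /= km ->; exact: reach.
rewrite /orbit_sum groupE -fsbig_seq // big_map big_seq [RHS]big_seq.
by apply: eq_bigr => k; rewrite mem_iota => /= km; rewrite sgnE.
Qed.

(** * Nonvanishing by positivity *)

Section Positivity.
Variables a b : rat.
Hypotheses (a0 : 0 < a) (b0 : 0 < b).

Definition point (i : 'I_2) : rat := if val i == 0%N then a else b.

Definition positive (F : ratfun2) : Prop :=
  exists2 c : rat, 0 < c & evaluates (meval point) F c.

Lemma evaluates_x2 : evaluates (meval point) x2 a.
Proof.
have := evaluates_poly (meval point) 'X_(@Ordinal 2 0 isT).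
by rewrite /= mevalXU.
Qed.

Lemma evaluates_y2 : evaluates (meval point) y2 b.
Proof.
have := evaluates_poly (meval point) 'X_(@Ordinal 2 1 isT).
by rewrite /= mevalXU.
Qed.

Lemma positive_x2 : positive x2.
Proof. by exists a => //; exact: evaluates_x2. Qed.

Lemma positive_y2 : positive y2.
Proof. by exists b => //; exact: evaluates_y2. Qed.

Lemma positiveM (F G : ratfun2) : positive F -> positive G -> positive (F * G).
Proof.
move=> [c c0 Fc] [d d0 Gd]; exists (c * d); first exact: mulr_gt0.
exact: evaluatesM.
Qed.

Lemma positiveV (F : ratfun2) : positive F -> positive F^-1.
Proof.
move=> [c c0 Fc]; exists c^-1; first by rewrite invr_gt0.
by apply: evaluatesV => //; rewrite gt_eqF.
Qed.

Lemma positive_neq0 (F : ratfun2) : positive F -> F != 0.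
Proof.
move=> [c c0 Fc]; apply/eqP => F0.
have := evaluates_poly (meval point) 0; rewrite !rmorph0 -F0 => /(evaluates_fun _ _ _ _ Fc).
by move=> cE; rewrite cE ltxx in c0.
Qed.

Lemma sum_exp_gt0 (T : eqType) (s : seq T) (p : pred T) (f : T -> int) (c : rat) :
  0 < c -> has p s -> 0 < \sum_(i <- s | p i) c ^ f i.
Proof.
move=> c0; elim: s => [//|i s IH] /=; rewrite big_cons.
have s0 : 0 <= \sum_(i <- s | p i) c ^ f i.
  by apply: sumr_ge0 => j _; rewrite exprz_ge0 // ltW.
by case: ifP => [_ _|_ /IH //]; rewrite ltr_wpDr // exprz_gt0.
Qed.

Lemma positive_charA (St : stepset) (k : int) (F : ratfun2) :
  has (fun s => s.2 == k) St -> positive F -> positive (charA St k F).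
Proof.
move=> hk [c c0 Fc]; exists (charA St k c); first exact: sum_exp_gt0.
by apply: evaluates_charA => //; rewrite gt_eqF.
Qed.

Lemma positive_charB (St : stepset) (k : int) (F : ratfun2) :
  has (fun s => s.1 == k) St -> positive F -> positive (charB St k F).
Proof.
move=> hk [c c0 Fc]; exists (charB St k c); first exact: sum_exp_gt0.
by apply: evaluates_charB => //; rewrite gt_eqF.
Qed.

End Positivity.

(** * Step sets with monomial reflections *)

(** Laurent polynomials as lists of monomials, [true] marking a minus sign; antisymmetry becomes a
    [perm_eq] check. *)
Definition signed_monomials := seq (bool * (int * int)).

Definition monomial_sum (L : fieldType) (M : signed_monomials) (x y : L) : L :=
  \sum_(bm <- M) (-1) ^+ bm.1 * (x ^ bm.2.1 * y ^ bm.2.2).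

Definition monomial_coef (M : signed_monomials) (p q : int) : rat :=
  \sum_(bm <- M) (-1) ^+ bm.1 * ((p, q) == bm.2)%:R.

Lemma evaluates_monomial_sum (M : signed_monomials) :
  evaluates inv_poly (monomial_sum _ M x2 y2) (monomial_sum _ M x3^-1 y3^-1).
Proof.
apply: evaluates_sum => -[b m] _; apply: evaluatesM; first exact: evaluatesN1.
apply: evaluatesM; apply: evaluatesXz.
- by rewrite invr_eq0 x3_neq0.
- exact: evaluates_inv_x2.
- by rewrite invr_eq0 y3_neq0.
- exact: evaluates_inv_y2.
Qed.

Lemma monomial_sumV (L : fieldType) (M : signed_monomials) (x y : L) :
  x != 0 -> y != 0 ->
  x * y * monomial_sum _ M x^-1 y^-1 =
  \sum_(bm <- M) (-1) ^+ bm.1 * (x ^ (1 - bm.2.1) * (y ^ (1 - bm.2.2) * 1)).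
Proof.
move=> x0 y0; rewrite /monomial_sum mulr_sumr; apply: eq_bigr => -[b m] _ /=.
by rewrite !expfzDr // !expr1z !exprz_inv; ring.
Qed.

Lemma expands0 : expands 0 (fun _ _ _ => 0).
Proof.
exists 0, 1; rewrite oner_eq0 rmorph0 mul0r; split=> // i j k.
by rewrite poly_mul1 poly_mul0.
Qed.

Lemma expands_monomial_sum (M : signed_monomials) :
  expands (x3 * y3 * monomial_sum _ M x3^-1 y3^-1)
    (fun i j k => (k == 0)%:R * monomial_coef M (1 - i) (1 - j)).
Proof.
rewrite (monomial_sumV _ _ _ _ x3_neq0 y3_neq0) /monomial_coef.
elim: M => [|[b m] M IH].
  rewrite big_nil; apply: (expands_ext _ expands0) => i j k.
  by rewrite big_nil mulr0.
rewrite big_cons; have := expandsZ ((-1) ^+ b) _ _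
  (expands_x (1 - m.1) _ _ (expands_y (1 - m.2) _ _ expands1)).
rewrite rmorphXn rmorphN1 tofracXn tofracN tofrac1 => /expandsD /(_ IH).
move=> /expands_ext; apply=> i j k; rewrite big_cons mulrDr; congr (_ + _) => /=.
rewrite mulrCA /laurent1 -!natrM -pair_eqE /=.
congr (_ * _%:R); rewrite !mulnb; congr (nat_of_bool _); lia.
Qed.

Lemma monomial_coef_antisym (M : signed_monomials) (phi : int * int -> int * int)
    (p : int * int) :
  involutive phi -> perm_eq [seq (~~ bm.1, phi bm.2) | bm <- M] M ->
  monomial_coef M (phi p).1 (phi p).2 = - monomial_coef M p.1 p.2.
Proof.
move=> phiK phiM; rewrite /monomial_coef -(perm_big _ phiM) big_map -sumrN.
apply: eq_bigr => -[b m] _; rewrite -!surjective_pairing (inj_eq (inv_inj phiK)).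
by case: b; rewrite /= expr0 expr1 mul1r mulN1r ?opprK.
Qed.

(** Both antisymmetries hold on all of Z^2, and each reflection fixes one axis pointwise. The
    conditions on [M] say that xy is its only monomial in the open quadrant and occurs once, with
    sign plus. *)
Lemma is_diagonal_monomials (St : stepset) (l : seq (int * int))
    (M : signed_monomials) (phi psi : int * int -> int * int) (a b : nat) :
  (a <= 1)%N -> (b <= 1)%N ->
  perm_eq St l -> small_steps l ->
  {morph phi : u v / u - v} -> {morph psi : u v / u - v} ->
  involutive phi -> involutive psi ->
  (forall p, phi (p, 0) = (p, 0)) -> (forall q, psi (0, q) = (0, q)) ->
  perm_eq (map phi l) l -> perm_eq (map psi l) l ->
  perm_eq [seq (~~ bm.1, phi bm.2) | bm <- M] M ->
  perm_eq [seq (~~ bm.1, psi bm.2) | bm <- M] M ->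
  all (fun bm => ~~ ((1 <= bm.2.1) && (1 <= bm.2.2)) || (bm == (false, (1, 1)))) M ->
  count_mem (false, (1, 1)) M = 1%N ->
  orbit_sum St = monomial_sum _ M x2 y2 ->
  is_diagonal
    (x3 * y3 * ratfun_eval (orbit_sum St) x3^-1 y3^-1
       / (1 - t3 * x3 * y3 * charS St x3^-1 y3^-1)
     * ((1 - x3) ^- a * (1 - y3) ^- b))
    (walk_gf St a%:R b%:R).
Proof.
move=> a1 b1 lE small phiB psiB phiK psiK phi0 psi0 phil psil phiM psiM M1 M11 OE.
pose D : nat := \max_(bm <- M) maxn `|bm.2.1|%N `|bm.2.2|%N.
have eq0 (z : rat) : z = - z -> z = 0 by move=> ?; lra.
rewrite OE (ratfun_evalE _ _ (evaluates_monomial_sum M)).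
apply: (is_diagonal_step_iter _ (monomial_coef M) D) => //.
- by rewrite /small_steps (perm_all _ lE).
- exact: expands_monomial_sum.
- move=> p q pq; rewrite /monomial_coef big_seq big1 // => bm bmM.
  case: eqP => [pqE|]; last by rewrite mulr0.
  have : (maxn `|bm.2.1|%N `|bm.2.2|%N <= D)%N.
    by rewrite /D (big_rem _ bmM) /= leq_maxl.
  by move: pq; rewrite -pqE /=; lia.
- move=> p q p1 q1; rewrite /monomial_coef.
  have cE : (\sum_(bm <- M) (bm == (false, (1%R, 1%R))) = 1)%N.
    rewrite -M11 -sum1_count [RHS]big_mkcond.
    by apply: eq_bigr => bm _ /=; case: eqP.
  rewrite (eq_big_seq (fun bm => (bm == (false, (1, 1)))%:R
      * ((p, q) == (1, 1))%:R)).
    by rewrite -mulr_suml -natr_sum cE mul1r -pair_eqE.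
  move=> bm /(allP M1); case: eqP => [->|_].
    by rewrite /= expr0 !mul1r.
  rewrite orbF => bm1; rewrite mul0r.
  case: eqP => [pqE|]; last by rewrite mulr0.
  by move: bm1; rewrite -pqE p1 q1.
- move=> n p _; apply: eq0; rewrite (step_iter_perm _ _ _ _ _ _ lE).
  have := step_iter_antisym l _ _ n (p, 0) phiB phil
    (fun p => monomial_coef_antisym M _ p phiK phiM).
  by rewrite phi0.
- move=> n q _; apply: eq0; rewrite (step_iter_perm _ _ _ _ _ _ lE).
  have := step_iter_antisym l _ _ n (0, q) psiB psil
    (fun p => monomial_coef_antisym M _ p psiK psiM).
  by rewrite psi0.
Qed.

Definition monomial (m : int * int) : ratfun2 := x2 ^ m.1 * y2 ^ m.2.

Lemma x2_neq0 : x2 != 0.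
Proof. exact: (positive_neq0 1 1 _ (positive_x2 1 1 _)). Qed.

Lemma y2_neq0 : y2 != 0.
Proof. exact: (positive_neq0 1 1 _ (positive_y2 1 1 _)). Qed.

Lemma expfz2D (L : fieldType) (x y : L) (m m' : int * int) :
  x != 0 -> y != 0 ->
  x ^ (m + m').1 * y ^ (m + m').2 = x ^ m.1 * y ^ m.2 * (x ^ m'.1 * y ^ m'.2).
Proof. by move=> x0 y0; rewrite !expfzDr // mulrACA. Qed.

Lemma monomialD (m m' : int * int) :
  monomial (m + m') = monomial m * monomial m'.
Proof. exact: expfz2D _ _ _ _ _ x2_neq0 y2_neq0. Qed.

Lemma monomialN (m : int * int) : monomial (- m) = (monomial m)^-1.
Proof. by rewrite /monomial invfM !invr_expz. Qed.

Lemma monomialMn (m : int * int) (n : nat) :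
  monomial (m *+ n) = monomial m ^+ n.
Proof.
elim: n => [|n IH]; first by rewrite mulr0n /monomial !expr0z mulr1.
by rewrite mulrS exprS monomialD IH.
Qed.

Lemma evaluates_monomial (a b : rat) (m : int * int) : a != 0 -> b != 0 ->
  evaluates (meval (point a b)) (monomial m) (a ^ m.1 * b ^ m.2).
Proof.
move=> a0 b0; apply: evaluatesM; apply: evaluatesXz => //.
  exact: evaluates_x2.
exact: evaluates_y2.
Qed.

(** At (2, 1) and (1, 2) a monomial becomes a power of 2, which reveals one exponent each time. *)
Lemma monomial_inj : injective monomial.
Proof.
move=> m m' mE.
have eqE (a b : rat) : a != 0 -> b != 0 ->
    a ^ m.1 * b ^ m.2 = a ^ m'.1 * b ^ m'.2.
  move=> a0 b0; apply: (evaluates_fun (meval (point a b)) (monomial m)).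
    exact: evaluates_monomial.
  by rewrite mE; apply: evaluates_monomial.
have exp2I : injective (exprz (2 : rat)) by apply: ieexprIz.
have := eqE 2 1 isT isT; rewrite !exp1rz !mulr1 => /exp2I m1.
have := eqE 1 2 isT isT; rewrite !exp1rz !mul1r => /exp2I m2.
by rewrite [m]surjective_pairing m1 m2 -surjective_pairing.
Qed.

Lemma positive_monomial (m : int * int) : positive 1 1 (monomial m).
Proof.
exists 1 => //; have := evaluates_monomial 1 1 m isT isT.
by rewrite !exp1rz mulr1.
Qed.

(* Exponents of Phi g and Psi g for a pair g of monomials, when
   Phi (x, y) = (x, x ^+ eps / y) and Psi (x, y) = (y / x, y). *)
Definition Phi_exp (eps : nat) (g : (int * int) * (int * int)) :=
  (g.1, g.1 *+ eps - g.2).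
Definition Psi_exp (g : (int * int) * (int * int)) := (g.2 - g.1, g.2).

Fixpoint orbit_exp (eps k : nat) : (int * int) * (int * int) :=
  if k is k'.+1 then
    if odd k then Phi_exp eps (orbit_exp eps k') else Psi_exp (orbit_exp eps k')
  else ((1, 0), (0, 1)).

Definition orbit_monomials (eps m : nat) : signed_monomials :=
  [seq (odd k, (orbit_exp eps k).1 + (orbit_exp eps k).2) | k <- iota 0 m.*2].

(** Substituting (x, x^eps / y), or (y / x, y) below, in a monomial, read on exponents. This
    composes with the reflection on the right, whereas [Phi_exp] and [Psi_exp] compose on the
    left. *)
Definition Phi_lin (eps : nat) (p : int * int) : int * int :=
  (p.1 + p.2 *+ eps, - p.2).
Definition Psi_lin (p : int * int) : int * int := (- p.1, p.1 + p.2).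

Lemma Phi_linB (eps : nat) : {morph Phi_lin eps : u v / u - v}.
Proof.
move=> [u1 u2] [v1 v2]; rewrite /Phi_lin /= mulrnBl.
by congr pair => /=; rewrite opprD // addrACA.
Qed.

Lemma Psi_linB : {morph Psi_lin : u v / u - v}.
Proof.
move=> [u1 u2] [v1 v2]; rewrite /Psi_lin /=.
by congr pair => /=; rewrite opprD // addrACA.
Qed.

Lemma Phi_linK (eps : nat) : involutive (Phi_lin eps).
Proof. by move=> [u1 u2]; rewrite /Phi_lin /= mulNrn addrK opprK. Qed.

Lemma Psi_linK : involutive Psi_lin.
Proof. by move=> [u1 u2]; rewrite /Psi_lin /= opprK addKr. Qed.

(** The finite facts about one step set, gathered to be decided by computation. The orbit has 2m
    elements, and eps is the exponent in A_{-1} = x^eps A_1. *)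
Definition dihedral_check (l : seq (int * int)) (eps m : nat) : bool :=
  let M := orbit_monomials eps m in
  let ks := iota 0 m.*2 in
  [&& [&& (0 < m)%N, small_steps l, has (fun s => s.2 == 1) l
      & has (fun s => s.1 == 1) l],
  [&& all (fun k => Phi_exp eps (orbit_exp eps k)
                    == orbit_exp eps (Phi_index k)) ks,
      all (fun k => Psi_exp (orbit_exp eps k)
                    == orbit_exp eps (Psi_index m k)) ks
    & uniq [seq orbit_exp eps k | k <- ks]] &
  [&& perm_eq (map (Phi_lin eps) l) l, perm_eq (map Psi_lin l) l,
      perm_eq [seq (~~ bm.1, Phi_lin eps bm.2) | bm <- M] M,
      perm_eq [seq (~~ bm.1, Psi_lin bm.2) | bm <- M] M
    & all (fun bm => ~~ ((1 <= bm.2.1) && (1 <= bm.2.2))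
                     || (bm == (false, (1, 1)))) M
      && (count_mem (false, (1, 1)) M == 1%N)]].

Lemma mulf_cancel (L : fieldType) (w a b c : L) :
  b != 0 -> a = c * b -> w * a / b = c * w.
Proof. by move=> b0 ->; rewrite mulrA mulfK // mulrC. Qed.

Lemma is_diagonal_dihedral (St : stepset) (l : seq (int * int)) (eps m a b : nat) :
  (a <= 1)%N -> (b <= 1)%N -> perm_eq St l -> dihedral_check l eps m ->
  (forall (L : fieldType) (u : L), u != 0 ->
    charA St (-1) u = u ^+ eps * charA St 1 u) ->
  (forall (L : fieldType) (v : L), v != 0 ->
    charB St (-1) v = v * charB St 1 v) ->
  is_diagonal
    (x3 * y3 * ratfun_eval (orbit_sum St) x3^-1 y3^-1
       / (1 - t3 * x3 * y3 * charS St x3^-1 y3^-1)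
     * ((1 - x3) ^- a * (1 - y3) ^- b))
    (walk_gf St a%:R b%:R).
Proof.
move=> a1 b1 lE /and3P[/and4P[m0 small up right]].
move=> /and3P[/allP phiE /allP psiE uE] /and5P[phil psil phiM psiM /andP[M1 /eqP M11]] hA hB.
pose e k : birat := (monomial (orbit_exp eps k).1, monomial (orbit_exp eps k).2).
have mon0 p : monomial p != 0 by apply: positive_neq0 (positive_monomial p).
apply: (is_diagonal_monomials St l (orbit_monomials eps m) (Phi_lin eps) Psi_lin)
  => //.
- exact: Phi_linB.
- exact: Psi_linB.
- exact: Phi_linK.
- exact: Psi_linK.
- by move=> p; rewrite /Phi_lin /= mul0rn addr0 oppr0.
- by move=> q; rewrite /Psi_lin /= oppr0 add0r.
rewrite (orbit_sum_cycle St m e) //.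
- rewrite /monomial_sum big_map; apply: eq_bigr => k _.
  by rewrite -monomialD signr_odd.
- by rewrite /e /monomial /= !expr0z !expr1z mulr1 mul1r.
- move=> k km; rewrite /e -(eqP (phiE k _)) ?mem_iota //.
  rewrite /Phi /= monomialD monomialMn monomialN.
  have A1 : charA St 1 (monomial (orbit_exp eps k).1) != 0.
    apply: (positive_neq0 1 1); apply: positive_charA (positive_monomial _) => //.
    by rewrite (perm_has _ lE).
  by rewrite (mulf_cancel _ _ _ _ _ A1 (hA _ _ (mon0 _))).
- move=> k km; rewrite /e -(eqP (psiE k _)) ?mem_iota //.
  rewrite /Psi /= monomialD monomialN.
  have B1 : charB St 1 (monomial (orbit_exp eps k).2) != 0.
    apply: (positive_neq0 1 1); apply: positive_charB (positive_monomial _) => //.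
    by rewrite (perm_has _ lE).
  by rewrite (mulf_cancel _ _ _ _ _ B1 (hB _ _ (mon0 _))).
rewrite map_inj_in_uniq ?iota_uniq // => k k'; rewrite !mem_iota /= => km km'.
move=> [/monomial_inj e1 /monomial_inj e2].
apply: (uniq_map_iota_inj _ _ _ _ _ uE km km').
by rewrite [LHS]surjective_pairing e1 e2 -surjective_pairing.
Qed.

Definition tandem := [:: dN; dW; dSE].
Definition double_tandem := [:: dNW; dSE; dN; dS; dE; dW].
Definition gouyou_beauchamps := [:: dE; dSE; dW; dNW].

Lemma dihedral_checks :
  [/\ dihedral_check tandem 1 3, dihedral_check double_tandem 1 3
    & dihedral_check gouyou_beauchamps 2 4].
Proof. by split; vm_compute. Qed.

Lemma charAB_dihedral (L : fieldType) (St : stepset) (eps : nat)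
    (l : seq (int * int)) (u : L) :
  (l, eps) \in [:: (tandem, 1%N); (double_tandem, 1%N); (gouyou_beauchamps, 2%N)] ->
  perm_eq St l -> u != 0 ->
  charA St (-1) u = u ^+ eps * charA St 1 u /\
  charB St (-1) u = u * charB St 1 u.
Proof.
move=> lS lE u0; rewrite /charA /charB !(perm_big _ lE) /= {lE}.
by move: lS; rewrite !inE => /or3P[]/eqP[-> ->]; rewrite !big_cons !big_nil /=;
   rewrite ?expr1z ?expr0z ?exprN1; split; field.
Qed.

(** * Step sets symmetric in a vertical axis *)

Definition flip_step (s : int * int) : int * int := (- s.1, s.2).

Definition vertically_symmetric (l : seq (int * int)) : bool :=
  [&& small_steps l, perm_eq (map flip_step l) l,
      has (perm_eq (upper_row l)) upper_row_shapes &
  [&& has (fun s => s.2 == 1) l, has (fun s => s.2 == -1) l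
    & has (fun s => s.1 == 1) l]].

Lemma vertically_symmetric_perm (l l' : seq (int * int)) :
  perm_eq l l' -> vertically_symmetric l' -> vertically_symmetric l.
Proof.
move=> ll'; rewrite /vertically_symmetric /small_steps !(perm_has _ ll').
rewrite (perm_all _ ll').
have upE : perm_eq (upper_row l) (upper_row l').
  by apply: perm_map; apply: perm_filter.
have -> : has (perm_eq (upper_row l)) upper_row_shapes =
    has (perm_eq (upper_row l')) upper_row_shapes.
  by apply: eq_has => s; rewrite (permPl upE).
by rewrite (permPl (perm_map flip_step ll')) (permPr ll').
Qed.

Lemma charA_flip (L : fieldType) (St : stepset) (k : int) (x : L) :
  perm_eq (map flip_step St) St -> charA St k x^-1 = charA St k x.
Proof.
move=> flip; rewrite /charA -[RHS](perm_big _ flip) big_map.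
by apply: eq_bigr => s _; rewrite /= exprz_inv.
Qed.

Lemma charB_flip (L : fieldType) (St : stepset) (y : L) :
  perm_eq (map flip_step St) St -> charB St (-1) y = charB St 1 y.
Proof.
move=> flip; rewrite /charB -[LHS](perm_big _ flip) big_map.
by apply: eq_bigl => s /=; rewrite eqr_oppLR opprK.
Qed.

Definition reflect_y (L : fieldType) (St : stepset) (x y : L) : L :=
  y^-1 * charA St (-1) x / charA St 1 x.

(** Under the symmetry B_{-1} = B_1 and A_k(1/x) = A_k(x), so Psi is x -> 1/x and commutes with Phi.
    The field is arbitrary because the orbit is needed at (x, y) and at (1/x, 1/y). *)
Definition square_orbit (L : fieldType) (St : stepset) (x y : L) (k : nat) : L * L :=
  nth (x, y) [:: (x, y); (x, reflect_y _ St x y); (x^-1, reflect_y _ St x y);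
                 (x^-1, y)] k.

Lemma reflect_yK (L : fieldType) (y a b : L) :
  y != 0 -> a != 0 -> b != 0 -> (y^-1 * a / b)^-1 * a / b = y.
Proof.
by move=> y0 a0 b0; field; rewrite y0 a0 b0.
Qed.

Lemma mulf_div_same (L : fieldType) (w a : L) : a != 0 -> w * a / a = w.
Proof. by move=> a0; rewrite mulfK. Qed.

Section SymmetricOrbit.
Variable St : stepset.
Hypothesis symSt : vertically_symmetric St.

Let flip : perm_eq (map flip_step St) St.
Proof. by have /and4P[] := symSt. Qed.

Lemma positive_charA_sym (a b : rat) (k : int) (F : ratfun2) :
  0 < a -> 0 < b -> k \in [:: 1; -1] -> positive a b F ->
  positive a b (charA St k F).
Proof.
move=> a0 b0 kP; apply: positive_charA.
by have /and4P[_ _ _ /and3P[]] := symSt; move: kP; rewrite !inE => /orP[]/eqP->.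
Qed.

Lemma positive_reflect_y (a b : rat) :
  0 < a -> 0 < b -> positive a b (reflect_y _ St x2 y2).
Proof.
move=> a0 b0; apply: positiveM; last first.
  by apply: positiveV => //; apply: positive_charA_sym => //; exact: positive_x2.
apply: positiveM; first by apply: positiveV => //; exact: positive_y2.
by apply: positive_charA_sym => //; exact: positive_x2.
Qed.

Lemma charA_x2_neq0 (k : int) : k \in [:: 1; -1] -> charA St k x2 != 0.
Proof.
move=> kP; apply: (positive_neq0 1 1); apply: positive_charA_sym => //.
exact: positive_x2.
Qed.

Lemma Psi_sym (u v : ratfun2) : positive 1 1 v -> Psi St (u, v) = (u^-1, v).
Proof.
move=> v0; have B0 : charB St 1 v != 0.
  apply: (positive_neq0 1 1); apply: positive_charB => //.
  by have /and4P[_ _ _ /and3P[]] := symSt.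
by rewrite /Psi /= (charB_flip _ _ _ flip) (mulf_div_same _ _ _ B0).
Qed.

Lemma x2_neqV : x2 <> x2^-1.
Proof.
move=> xE; have := evaluates_x2 2 1.
have /evaluates_fun/[apply] : evaluates (meval (point 2 1)) x2 2^-1.
  by rewrite xE; apply: evaluatesV => //; exact: evaluates_x2.
by move/eqP.
Qed.

(** On the line x = 1 equality would force c^2 = A_{-1}(1)/A_1(1) for every c > 0; c = 1 and c = 2
    disagree. *)
Lemma y2_neq_reflect : y2 <> reflect_y _ St x2 y2.
Proof.
move=> yE.
pose a : rat := charA St (-1) 1; pose b : rat := charA St 1 1.
have b0 : 0 < b.
  by apply: sum_exp_gt0 => //; have /and4P[_ _ _ /and3P[]] := symSt.
have yc (c : rat) : 0 < c -> c = c^-1 * a / b.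
  move=> c0; apply: (evaluates_fun (meval (point 1 c)) y2).
    exact: evaluates_y2.
  rewrite yE; apply: evaluatesM.
    apply: evaluatesM; last by apply: evaluates_charA => //; exact: evaluates_x2.
    by apply: evaluatesV; [rewrite gt_eqF | exact: evaluates_y2].
  apply: evaluatesV; first by rewrite gt_eqF.
  by apply: evaluates_charA => //; exact: evaluates_x2.
have h1 : a / b = 1 by have := yc 1 isT; rewrite invr1 mul1r => <-.
by have := yc 2 isT; rewrite -mulrA h1 mulr1 => /eqP.
Qed.

Lemma orbit_sum_symmetric :
  orbit_sum St = \sum_(k <- iota 0 4) (-1) ^+ k *
    ((square_orbit _ St x2 y2 k).1 * (square_orbit _ St x2 y2 k).2).
Proof.
have y0 : positive 1 1 y2 by exact: positive_y2.
have w0 : positive 1 1 (reflect_y _ St x2 y2) by exact: positive_reflect_y.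
have PhiK : reflect_y _ St x2 (reflect_y _ St x2 y2) = y2.
  by apply: reflect_yK; [exact: y2_neq0 | exact: charA_x2_neq0..].
have reflectV v : reflect_y _ St x2^-1 v = reflect_y _ St x2 v.
  by rewrite /reflect_y !(charA_flip _ _ _ _ flip).
have PhiE u v : Phi St (u, v) = (u, reflect_y _ St u v) by [].
apply: (orbit_sum_cycle St 2) => //.
- move=> [|[|[|[|//]]]] _; rewrite /square_orbit [nth _ _ _]/= PhiE.
  + by [].
  + by rewrite PhiK.
  + by rewrite reflectV PhiK.
  + by rewrite reflectV.
- move=> [|[|[|[|//]]]] _; rewrite /square_orbit [nth _ _ _]/=.
  + exact: (Psi_sym _ _ y0).
  + exact: (Psi_sym _ _ w0).
  + by rewrite (Psi_sym _ _ w0) invrK.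
  + by rewrite (Psi_sym _ _ y0) invrK.
have x1 : (x2 == x2^-1) = false by apply/eqP; exact: x2_neqV.
have y1 : (y2 == reflect_y _ St x2 y2) = false by apply/eqP; exact: y2_neq_reflect.
rewrite [map _ _]/= /square_orbit [nth _ _ _]/= !cons_uniq !inE !xpair_eqE.
have y1' : (reflect_y _ St x2 y2 == y2) = false by rewrite eq_sym.
by rewrite !eqxx x1 y1 y1'.
Qed.

Lemma evaluates_inv_neq0 (F : ratfun2) (c : ratfun3) :
  evaluates inv_poly F c -> F != 0 -> c != 0.
Proof.
move=> [P [Q [Q0 -> ->]]] F0; apply: mulf_neq0 (invr_neq0 Q0).
by apply/eqP => /inv_poly_inj P0; rewrite P0 tofrac0 mul0r eqxx in F0.
Qed.

Lemma evaluates_inv_charA (k : int) :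
  evaluates inv_poly (charA St k x2) (charA St k x3^-1).
Proof.
apply: evaluates_charA; last exact: evaluates_inv_x2.
by rewrite invr_eq0 x3_neq0.
Qed.

Lemma charA_x3_neq0 : charA St 1 x3^-1 != 0.
Proof. exact: evaluates_inv_neq0 (evaluates_inv_charA 1) (charA_x2_neq0 1 isT). Qed.

Lemma evaluates_square_orbit (k : nat) : (k < 4)%N ->
  let e2 := square_orbit _ St x2 y2 k in
  let e3 := square_orbit _ St x3^-1 y3^-1 k in
  evaluates inv_poly e2.1 e3.1 /\ evaluates inv_poly e2.2 e3.2.
Proof.
have xE := evaluates_inv_x2; have yE := evaluates_inv_y2.
have x0 : x3^-1 != 0 by rewrite invr_eq0 x3_neq0.
have y0 : y3^-1 != 0 by rewrite invr_eq0 y3_neq0.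
have xV := evaluatesV _ _ _ x0 xE.
have wE : evaluates inv_poly (reflect_y _ St x2 y2) (reflect_y _ St x3^-1 y3^-1).
  apply: evaluatesM; last exact: evaluatesV charA_x3_neq0 (evaluates_inv_charA 1).
  exact: evaluatesM (evaluatesV _ _ _ y0 yE) (evaluates_inv_charA (-1)).
by case: k => [|[|[|[|//]]]].
Qed.

(** Meant for a = A_{-1}(1/x) and b = A_1(1/x): the common factor x clears negative powers, as x a
    and x b are polynomials. *)
Lemma square_orbit_sum (L : fieldType) (x y a b : L) :
  x != 0 -> y != 0 -> b != 0 ->
  let w := y^-1^-1 * a / b in
  x * y * (x^-1 * y^-1 - x^-1 * w + x^-1^-1 * w - x^-1^-1 * y^-1) =
  (1 - x ^+ 2) * (x * b - y ^+ 2 * (x * a)) / (x * b).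
Proof. by move=> x0 y0 b0 /=; rewrite !invrK; field; rewrite ?x0 ?y0 ?b0. Qed.

Definition row_poly (k : int) : {mpoly rat[3]} :=
  \sum_(s <- St | s.2 == k) 'X_(@Ordinal 3 0 isT) ^+ `|1 - s.1|%N.

Let small : small_steps St.
Proof. by have /and4P[] := symSt. Qed.

Lemma row_polyE (k : int) :
  FracField.tofrac (row_poly k) = x3 * charA St k x3^-1.
Proof.
rewrite rmorph_sum mulr_sumr /= big_seq_cond [RHS]big_seq_cond.
apply: eq_bigr => s /andP[/(allP small)/andP[s1 _] _].
rewrite -(expr_absz _ _ _ x3_neq0 s1); exact: tofracXn.
Qed.

Lemma row_poly_neq0 : row_poly 1 != 0.
Proof.
rewrite -tofrac_eq0 row_polyE; exact: mulf_neq0 x3_neq0 charA_x3_neq0.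
Qed.

Lemma poly_mul_row (k : int) (f : laurent) (i j n : int) :
  poly_mul (row_poly k) f i j n = \sum_(s <- St | s.2 == k) f (i - 1 + s.1) j n.
Proof.
rewrite poly_mul_sum big_seq_cond [RHS]big_seq_cond.
apply: eq_bigr => -[s1 s2] /andP[/(allP small)]; rewrite !inE => ss _.
by rewrite poly_mulXx; congr (f _ _ _); move: ss => /=; lia.
Qed.

Definition symmetric_numerator : {mpoly rat[3]} :=
  (1 - 'X_(@Ordinal 3 0 isT) ^+ 2) *
  (row_poly 1 - 'X_(@Ordinal 3 1 isT) ^+ 2 * row_poly (-1)).

Lemma ratfun_eval_orbit_sum :
  x3 * y3 * ratfun_eval (orbit_sum St) x3^-1 y3^-1 =
  FracField.tofrac symmetric_numerator / FracField.tofrac (row_poly 1).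
Proof.
rewrite (ratfun_evalE _ (\sum_(k <- iota 0 4) (-1) ^+ k *
    ((square_orbit _ St x3^-1 y3^-1 k).1 * (square_orbit _ St x3^-1 y3^-1 k).2))).
  have xE : FracField.tofrac ('X_(@Ordinal 3 0 isT) ^+ 2) = x3 ^+ 2 := tofracXn _ _.
  have yE : FracField.tofrac ('X_(@Ordinal 3 1 isT) ^+ 2) = y3 ^+ 2 := tofracXn _ _.
  rewrite /symmetric_numerator tofracM !tofracB xE.
  rewrite [FracField.tofrac (_ * row_poly _)]tofracM yE !row_polyE.
  rewrite tofrac1 -[RHS](square_orbit_sum _ _ _ _ _ x3_neq0 y3_neq0 charA_x3_neq0).
  congr (_ * _); rewrite [iota 0 4]/= !big_cons big_nil expr0 expr1 mul1r mulN1r.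
  rewrite sqrrN expr1n mul1r exprS sqrrN expr1n mulr1 mulN1r addr0.
  by rewrite !addrA.
rewrite orbit_sum_symmetric big_seq [X in evaluates _ _ X]big_seq.
apply: evaluates_sum => k; rewrite mem_iota => /= k4.
have [e1 e2] := evaluates_square_orbit k k4.
exact: evaluatesM (evaluatesN1 _ _) (evaluatesM _ _ _ _ _ e1 e2).
Qed.

End SymmetricOrbit.

(** * Expanding the symmetric orbit sum at infinity *)

Definition reflected_delta (p : int) : rat := (p == 1)%:R - (p == -1)%:R.

(* Coefficients of O when kappa expands (x - 1/x) A_{-1}(x) / A_1(x) at infinity. *)
Definition square_coef (kappa : int -> rat) (p q : int) : rat :=
  (q == 1)%:R * reflected_delta p - (q == -1)%:R * kappa p.

Lemma square_coef_gt (kappa : int -> rat) (p q : int) :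
  (forall p, 3%:Z < p -> kappa p = 0) ->
  (3%:Z < p) || (3%:Z < q) -> square_coef kappa p q = 0.
Proof.
move=> kappa0 pq; rewrite /square_coef.
have [qE|q1] := eqVneq q 1; last have [qE|qN1] := eqVneq q (-1).
- have p1 : (p == 1) = false by lia.
  have pN1 : (p == -1) = false by lia.
  by rewrite qE /reflected_delta p1 pN1 subrr mulr0 mul0r subrr.
- by rewrite kappa0 ?mulr0 ?mul0r ?subrr //; lia.
- by rewrite !mul0r subrr.
Qed.

Lemma square_coef_quadrant (kappa : int -> rat) (p q : int) :
  1 <= p -> 1 <= q -> square_coef kappa p q = ((p == 1) && (q == 1))%:R.
Proof.
move=> p1 q1; rewrite /square_coef /reflected_delta.
have pN1 : (p == -1) = false by lia.
have qN1 : (q == -1) = false by lia.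
by rewrite pN1 qN1 mul0r !subr0 -natrM mulnb andbC.
Qed.

Lemma square_coefN (kappa : int -> rat) (p q : int) :
  1 <= q -> square_coef kappa (- p) q = - square_coef kappa p q.
Proof.
move=> q1; have qN1 : (q == -1) = false by lia.
rewrite /square_coef qN1 !mul0r !subr0 -mulrN /reflected_delta opprB.
by rewrite eqr_oppLR eqr_opp.
Qed.

(** Multiply A_{-1} (x - 1/x) by the expansion of 1/A_1. The latter has exponents at most 0 and the
    two factors raise them by at most one each, so the bound 3 leaves room to spare. *)
Lemma row_op_div (l : seq (int * int)) :
  small_steps l -> has (perm_eq (upper_row l)) upper_row_shapes ->
  exists2 kappa : int -> rat, (forall p, 3%:Z < p -> kappa p = 0)
    & row_op l 1 kappa = row_op l (-1) reflected_delta.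
Proof.
move=> /allP small /row_op_inverse[e e0 eE].
exists (row_op l (-1) (fun p => e (p - 1) - e (p + 1))) => [p p3|].
  rewrite /row_op big_seq_cond big1 // => -[s1 s2] /andP[/small].
  by rewrite !inE /= => ss _; rewrite !e0 ?subrr //; lia.
rewrite row_opC; congr row_op; apply: funext => p.
rewrite /row_op sumrB.
under eq_bigr do rewrite addrAC.
under [X in _ - X]eq_bigr do rewrite addrAC.
by have := eE; rewrite /row_op => eE'; rewrite !eE' subr_eq0 addr_eq0.
Qed.

(** After multiplication by the denominator x A_1(1/x), the row j = 0 is immediate and the row j = 2
    is the equation assumed of [kappa]. *)
Lemma expands_symmetric (St : stepset) (kappa : int -> rat) :
  vertically_symmetric St ->
  row_op St 1 kappa = row_op St (-1) reflected_delta ->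
  expands (x3 * y3 * ratfun_eval (orbit_sum St) x3^-1 y3^-1)
    (fun i j k => (k == 0)%:R * square_coef kappa (1 - i) (1 - j)).
Proof.
move=> sym kappaE; have /and4P[small _ _ _] := sym.
rewrite (ratfun_eval_orbit_sum _ sym).
have := expandsM (symmetric_numerator St) _ _ expands1; rewrite mulr1.
move/(expands_div _ _ _ _ (row_poly_neq0 _ sym)); apply=> i j k.
have row1 (m i' j' k' : int) :
    \sum_(s <- St | s.2 == m) laurent1 (i' - 1 + s.1) j' k' =
    ((j' == 0) && (k' == 0))%:R * \sum_(s <- St | s.2 == m) (i' - 1 + s.1 == 0)%:R.
  rewrite mulr_sumr; apply: eq_bigr => s _.
  by rewrite /laurent1 -andbA andbC -natrM mulnb.
(* The index 2 - i arises because x A_m(1/x) (1 - x^2) is x^2 times the value at 1/x of A_m(x) (x -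
   1/x). *)
have delta m : row_op St m reflected_delta (2 - i) =
    \sum_(s <- St | s.2 == m) (i - 1 + s.1 == 0)%:R
    - \sum_(s <- St | s.2 == m) (i - 2 - 1 + s.1 == 0)%:R.
  rewrite -sumrB; apply: eq_bigr => -[s1 s2] _; rewrite /reflected_delta /=.
  by congr (_%:R - _%:R); congr nat_of_bool; lia.
rewrite poly_mul_row // /symmetric_numerator poly_mulA poly_mulD poly_mul1.
have mulXy Q i' j' k' : poly_mul ('X_(@Ordinal 3 1 isT) ^+ 2 * Q) laurent1 i' j' k' =
    poly_mul Q laurent1 i' (j' - 2) k' by rewrite poly_mulA poly_mulXy.
rewrite poly_mulN poly_mulXx !poly_mulD !poly_mulN !mulXy.
rewrite !poly_mul_row // !row1.
have lhsE : \sum_(s <- St | s.2 == 1)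
    (k == 0)%:R * square_coef kappa (1 - (i - 1 + s.1)) (1 - j) =
  (k == 0)%:R * ((j == 0)%:R * row_op St 1 reflected_delta (2 - i)
    - (j - 2 == 0)%:R * row_op St 1 kappa (2 - i)).
  rewrite /row_op !mulr_sumr -sumrB mulr_sumr; apply: eq_bigr => -[s1 s2] _ /=.
  rewrite /square_coef (_ : 1 - (i - 1 + s1) = 2 - i - s1); last lia.
  by congr (_ * (_%:R * _ - _%:R * _)); congr nat_of_bool; lia.
rewrite lhsE kappaE !delta -!mulnb !natrM; ring.
Qed.

Lemma is_diagonal_symmetric (St : stepset) (a b : nat) :
  (a <= 1)%N -> (b <= 1)%N -> vertically_symmetric St ->
  is_diagonal
    (x3 * y3 * ratfun_eval (orbit_sum St) x3^-1 y3^-1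
       / (1 - t3 * x3 * y3 * charS St x3^-1 y3^-1)
     * ((1 - x3) ^- a * (1 - y3) ^- b))
    (walk_gf St a%:R b%:R).
Proof.
move=> a1 b1 sym; have /and4P[small flip shape _] := sym.
have [kappa kappa0 kappaE] := row_op_div _ small shape.
(* Only the rows 1 and -1 of O are nonzero, and for them the identity is A_1 kappa = A_{-1} (x -
   1/x). *)
have base m : iter m (row_op St 1) ((square_coef kappa)^~ (- m%:Z)) =
    fun p => - iter m (row_op St (-1)) ((square_coef kappa)^~ m%:Z) p.
  case: m => [|[|m]].
  - by apply: funext => p; rewrite /= /square_coef /= !mul0r subrr oppr0.
  - have -> : (square_coef kappa)^~ (- 1%:Z) = fun p => - kappa p.
      by apply: funext => p; rewrite /square_coef /= mul0r mul1r sub0r.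
    have -> : (square_coef kappa)^~ 1%:Z = reflected_delta.
      by apply: funext => p; rewrite /square_coef /= mul0r mul1r subr0.
    by rewrite /= row_opN kappaE.
  - have coef0 q : (q == 1) = false -> (q == -1) = false ->
        (square_coef kappa)^~ q = fun=> 0.
      by move=> q1 qN1; apply: funext => p; rewrite /square_coef q1 qN1 !mul0r subrr.
    rewrite !coef0 ?iter_row_op0; [|lia..].
    by apply: funext => p; rewrite oppr0.
have eq0 (z : rat) : z = - z -> z = 0 by move=> ?; lra.
have gp0 n p : step_iter St (square_coef kappa) n p 0 = 0.
  apply: eq0; have := step_iter_rows St (square_coef kappa) n 0 small base.
  by rewrite /= oppr0 => /(congr1 (@^~ p)).
apply: (is_diagonal_step_iter _ (square_coef kappa) 3) => //.
- exact: expands_symmetric.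
- by move=> p q pq; apply: square_coef_gt.
- by move=> p q p1 q1; apply: square_coef_quadrant.
(* The flip fixes p = 0, so the value there is its own negative. *)
- move=> n q q0; apply: eq0; rewrite -[X in step_iter _ _ _ X _ = _]oppr0.
  by apply: step_iter_flip => // p q' q1; apply: square_coefN.
Qed.

(** * The nineteen step sets *)

(** Explicit lists let the classification be decided by computation; the order of the steps is
    immaterial, as each list is used only up to [perm_eq]. *)
Definition step_lists : seq (seq (int * int)) :=
  [:: [:: dN; dS; dE; dW];
      [:: dNE; dSE; dNW; dSW];
      [:: dN; dS; dNE; dSE; dNW; dSW];
      [:: dN; dS; dE; dW; dNE; dNW; dSE; dSW];
      [:: dNE; dNW; dS];
      [:: dN; dNW; dNE; dS];
      [:: dNE; dNW; dE; dW; dS];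
      [:: dN; dNE; dNW; dSE; dSW];
      [:: dN; dNW; dNE; dE; dW; dS];
      [:: dN; dE; dW; dNE; dNW; dSE; dSW];
      tandem;
      double_tandem;
      [:: dN; dSE; dSW];
      [:: dN; dS; dSE; dSW];
      [:: dN; dE; dW; dSE; dSW];
      [:: dNE; dNW; dSE; dSW; dS];
      [:: dN; dE; dW; dS; dSW; dSE];
      [:: dNE; dNW; dE; dW; dSE; dSW; dS];
      gouyou_beauchamps].

Lemma step_lists_classification :
  all (fun l => vertically_symmetric l
         || (l \in [:: tandem; double_tandem; gouyou_beauchamps])) step_lists.
Proof. by vm_compute. Qed.

Lemma step_setsE : step_sets = [seq [fset s in l]%fset | l <- step_lists].
Proof.
rewrite /step_sets /= /tandem /double_tandem /gouyou_beauchamps.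
by do 19! (congr cons; first by apply/fsetP => s; rewrite !inE -?orbA ?orbF).
Qed.

Lemma step_sets_perm (St : stepset) : St \in step_sets ->
  exists2 l, l \in step_lists & perm_eq St l.
Proof.
rewrite step_setsE => /mapP[l lL ->]; exists l => //.
have /allP/(_ l lL) ul : all uniq step_lists by vm_compute.
by apply: uniq_perm; [exact: fset_uniq | exact: ul | move=> s; rewrite !inE].
Qed.

Theorem theorem2p3 (St : stepset) (hSt : St \in step_sets) (a b : nat)
    (ha : (a <= 1)%N) (hb : (b <= 1)%N) :
  is_diagonal
    (x3 * y3 * ratfun_eval (orbit_sum St) x3^-1 y3^-1
       / (1 - t3 * x3 * y3 * charS St x3^-1 y3^-1)
     * ((1 - x3) ^- a * (1 - y3) ^- b))
    (walk_gf St a%:R b%:R).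
Proof.
have dihedral l eps m :
    (l, eps) \in [:: (tandem, 1%N); (double_tandem, 1%N); (gouyou_beauchamps, 2%N)] ->
    dihedral_check l eps m -> perm_eq St l ->
    is_diagonal
      (x3 * y3 * ratfun_eval (orbit_sum St) x3^-1 y3^-1
         / (1 - t3 * x3 * y3 * charS St x3^-1 y3^-1)
       * ((1 - x3) ^- a * (1 - y3) ^- b))
      (walk_gf St a%:R b%:R).
  move=> lS check lE; apply: (is_diagonal_dihedral St l eps m) => // L u u0.
    by have [] := charAB_dihedral L St eps l u lS lE u0.
  by have [] := charAB_dihedral L St eps l u lS lE u0.
have [check1 check2 check3] := dihedral_checks.
have [l lL lE] := step_sets_perm St hSt.
have /orP[symSt|] := allP step_lists_classification l lL.
  exact: is_diagonal_symmetric ha hb (vertically_symmetric_perm _ _ lE symSt).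
rewrite !inE => /or3P[]/eqP lT; rewrite lT in lE.
- exact: (dihedral tandem 1%N 3).
- exact: (dihedral double_tandem 1%N 3).
- exact: (dihedral gouyou_beauchamps 2%N 4).
Qed.
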